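(* Let $T\in\mathcal{T}_h^\Gamma$ be an interface element (a triangle if $N=2$, a tetrahedron if $N=3$), without any angle restrictions. Then a pair $(\phi^+,\phi^-)\in\mathbb{P}_1(\mathbb{R}^N)\times\mathbb{P}_1(\mathbb{R}^N)$ is uniquely determined by the values $\mathcal{J}_{i,T}(\phi^+,\phi^-)$, $i=0,\dots,N$, and $\mathcal{M}_{F,T}(\phi^+,\phi^-)$, $F\in\mathcal{F}_T$; that is, for arbitrary prescribed real values of these $2N+2$ linear functionals there exists exactly one pair $(\phi^+,\phi^-)\in\mathbb{P}_1(\mathbb{R}^N)\times\mathbb{P}_1(\mathbb{R}^N)$ attaining them.
   Context: Geometry and coefficient. $N\in\{2,3\}$; $\Omega\subset\mathbb{R}^N$ is a convex polygonal (polyhedral) domain; $\Gamma$ is a closed $C^2$-smooth $(N-1)$-dimensional manifold immersed in $\Omega$, dividing $\Omega$ into $\Omega^+$ and $\Omega^-$ with $\Gamma=\partial\Omega^-$; $n$ is the unit normal to $\Gamma$ pointing toward $\Omega^+$. $\mathbb{B}(x)$ is a symmetric positive definite $N\times N$ matrix function, $\mathbb{B}^\pm=\mathbb{B}|_{\Omega^\pm}$ has entries in $C^1(\overline{\Omega^\pm})$, and there are positive constants $\beta_m^\pm,\beta_M^\pm$ with $\beta_M^\pm y^\top y\ge y^\top\mathbb{B}^\pm(x)y\ge\beta_m^\pm y^\top y$ for all $y\in\mathbb{R}^N$, $x\in\Omega^\pm$. Mesh. $\mathcal{T}_h$ is a simplicial triangulation of $\Omega$ from a shape-regular family, generated independently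 of $\Gamma$; elements $T$ and faces $F$ (edges if $N=2$) are open sets; $h_T=\mathrm{diam}(T)$; $\mathcal{F}_h$ is the set of faces and $\mathcal{F}_T$ the set of the $N+1$ faces of $T$. $\mathcal{T}_h^\Gamma=\{T:T\cap\Gamma\neq\emptyset\}$ (interface elements), $\mathcal{F}_h^\Gamma=\{F:F\cap\Gamma\ne\emptyset\}$, $\Gamma_T=\Gamma\cap T$, $T^\pm=T\cap\Omega^\pm$. It is assumed that for each triangle $\triangle\in\mathcal{T}_h^\Gamma$ ($N=2$) or $\triangle\in\mathcal{F}_h^\Gamma$ ($N=3$), $\Gamma\cap\partial\triangle$ consists of exactly two points lying on different edges, and for $N=3$, $\Gamma\cap\partial T$ is exactly one closed curve for $T\in\mathcal{T}_h^\Gamma$. Approximating plane. For $T\in\mathcal{T}_h^\Gamma$, $L_T$ is a plane (line if $N=2$) through a point $\bar x_{0,T}$ with unit normal $\bar n_T$, intersecting the same faces of $T$ as $\Gamma$, and such that there is $\tilde x_T\in\Gamma_T$ with $\tilde x_T-\bar x_{0,T}\perp L_T$ and $|\bar x_{0,T}-\tilde x_T|+h_T|\bar n_T-n(\tilde x_T)|\le Ch_T^2$ with $C$ independent of the mesh size and of how $\Gamma$ cuts the mesh. $L_T$ divides $T$ into $T_h^\pm=\{x\in T:\pm(x-\bar x_{0,T})\cdot\bar n_T>0\}$, approximating $T^\pm$. Let $\bar t_{i,T}$, $i=1,\dots,N-1$, be orthonormal vectors spanning the directions of $L_T$ (perpendicular to $\bar n_T$), $\mu>0$ a fixed constant, $\bar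 x_{i,T}=\bar x_{0,T}+\mu h_T\bar t_{i,T}$ for $i=1,\dots,N-1$, and $S_T=\{\bar x_{0,T}+\sum_{i=1}^{N-1}\zeta_i\bar t_{i,T}:0\le\zeta_i\le\mu h_T\}$. The map $\mathbf{p}_{h,T}:S_T\to\Gamma$, $\mathbf{p}_{h,T}(x)=x+\varrho_h\bar n_T$ with $\varrho_h$ the smallest value such that $x+\varrho_h\bar n_T\in\Gamma$, is assumed well-defined. Put $\tilde x_{0,T}=\mathbf{p}_{h,T}(\bar x_{0,T})$ and let $\mathbb{B}_T^\pm=\mathbb{B}^\pm(\tilde x_{0,T})$ (constant matrices). Functionals. $\mathbb{P}_1(\mathbb{R}^N)$ is the space of polynomials of degree at most one; $[\![v^\pm]\!]:=v^+-v^-$. The linear functionals on $\mathbb{P}_1(\mathbb{R}^N)\times\mathbb{P}_1(\mathbb{R}^N)$ are $\mathcal{J}_{i,T}(\phi^+,\phi^-)=[\![\phi^\pm]\!](\bar x_{i,T})$ for $i=0,\dots,N-1$; $\mathcal{J}_{N,T}(\phi^+,\phi^-)=[\![\mathbb{B}_T^\pm\nabla\phi^\pm\cdot\bar n_T]\!]=\mathbb{B}_T^+\nabla\phi^+\cdot\bar n_T-\mathbb{B}_T^-\nabla\phi^-\cdot\bar n_T$; and $\mathcal{M}_{F,T}(\phi^+,\phi^-)=\frac1{|F|}\big(\int_F\chi_{T_h^+}\phi^++\int_F\chi_{T_h^-}\phi^-\big)$ for $F\in\mathcal{F}_T$, where $\chi_{T_h^\pm}$ on $F$ denotes the characteristic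 function of the part $F\cap\partial T_h^\pm$ of $F$ on the corresponding side of $L_T$. *)

(* Defs.v *)
From HB Require Import structures.
From mathcomp Require Import all_boot all_order all_algebra.
From mathcomp Require Import all_classical all_reals all_analysis.

Set Implicit Arguments.
Unset Strict Implicit.
Unset Printing Implicit Defensive.

Import Order.TTheory GRing.Theory Num.Theory.
Import numFieldNormedType.Exports.

Local Open Scope classical_set_scope.
Local Open Scope ring_scope.

(* The space dimension is N = d.+1 and points of R^N are row vectors.  The
   library norm on 'rV[R]_N is the max norm, hence [enorm] for the Euclidean
   one; the topology is the same. *)

Section Euclidean.
Variables (R : realType) (d : nat).
Local Notation V := 'rV[R]_d.+1.

Definition dot (u v : V) : R := \sum_i u 0 i * v 0 i.

Definition enorm (u : V) : R := Num.sqrt (dot u u).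

Definition ediam (A : set V) : R :=
  sup [set r | exists x y, [/\ A x, A y & r = enorm (x - y)]].

Definition boundary (A : set V) : set V := closure A `\` A°.

Definition grad (f : V -> R) (x : V) : V := \row_i 'D_(delta_mx 0 i) f x.

Definition C1_on (U : set V) (f : V -> R) : Prop :=
  forall x, U x -> forall i,
    derivable f x (delta_mx 0 i) /\ {for x, continuous ('D_(delta_mx 0 i) f)}.

Definition C2_on (U : set V) (f : V -> R) : Prop :=
  C1_on U f /\ forall i, C1_on U ('D_(delta_mx 0 i) f).

(* f and its first partial derivatives on A extend continuously to closure A *)
Definition C1_closure (A : set V) (f : V -> R) : Prop :=
  {within closure A, continuous f} /\
  forall i, exists2 g : V -> R, {within closure A, continuous g} &
    forall x, A x -> is_derive x (delta_mx 0 i) f (g x).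

Definition quad_form (M : 'M[R]_d.+1) (y : V) : R := dot y (y *m M^T).

Definition sym_pos_def (M : 'M[R]_d.+1) : Prop :=
  M^T = M /\ forall y : V, y != 0 -> 0 < quad_form M y.

(* affine functions, i.e. polynomial functions of degree at most one on R^N *)
Definition is_P1 (f : V -> R) : Prop :=
  exists (c : R) (g : V), forall x, f x = c + dot g x.

End Euclidean.

Section Geometry.
Variables (R : realType) (d : nat).
Local Notation V := 'rV[R]_d.+1.

Definition convex_polyhedral_domain (Omega : set V) : Prop :=
  [/\ Omega !=set0, bounded_set Omega &
      exists (m : nat) (a : 'I_m -> V) (b : 'I_m -> R),
        Omega = [set x | forall i, dot (a i) x < b i]].

(* Gamma is a compact embedded C^2 hypersurface: locally it is the zero set of
   a C^2 function g with nonvanishing gradient.  As Gamma separates Op from Om,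
   g can be taken positive on Op and negative on Om, and then grad g gives the
   direction of the unit normal pointing toward Op. *)
Record interface (Omega Gamma Op Om : set V) (n : V -> V) : Prop := {
  interface_sub : Gamma `<=` Omega;
  interface_compact : compact Gamma;
  interface_split : Omega = Op `|` Gamma `|` Om;
  interface_disj : [/\ Op `&` Om = set0, Op `&` Gamma = set0 &
                       Om `&` Gamma = set0];
  interface_Op : open Op /\ Op !=set0;
  interface_Om : open Om /\ Om !=set0;
  interface_boundary : Gamma = boundary Om;
  interface_C2 : forall x, Gamma x ->
    exists (U : set V) (g : V -> R),
      [/\ open_nbhs x U, C2_on U g &
        forall y, U y ->
          [/\ Gamma y <-> g y = 0, Op y <-> 0 < g y, Om y <-> g y < 0,
              grad g y != 0 &
              Gamma y -> n y = (enorm (grad g y))^-1 *: grad g y]] }.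

(* Bp and Bm are the restrictions of B to Op and Om, extended to the closures;
   their values elsewhere are irrelevant, and so are those of B on Gamma. *)
Record coefficient (Op Om : set V) (B Bp Bm : V -> 'M[R]_d.+1) : Prop := {
  coefficient_spd : forall x, Op x \/ Om x -> sym_pos_def (B x);
  coefficient_p : forall x, Op x -> Bp x = B x;
  coefficient_m : forall x, Om x -> Bm x = B x;
  coefficient_C1p : forall i j, C1_closure Op (fun x => Bp x i j);
  coefficient_C1m : forall i j, C1_closure Om (fun x => Bm x i j);
  coefficient_boundp : exists betam betaM : R, [/\ 0 < betam, 0 < betaM &
    forall x y, Op x ->
      betam * dot y y <= quad_form (Bp x) y <= betaM * dot y y];
  coefficient_boundm : exists betam betaM : R, [/\ 0 < betam, 0 < betaM &
    forall x y, Om x ->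
      betam * dot y y <= quad_form (Bm x) y <= betaM * dot y y] }.

End Geometry.

(* An m-simplex in R^N is given by its m.+1 vertices c. *)
Section Simplices.
Variables (R : realType) (d : nat).
Local Notation V := 'rV[R]_d.+1.

Definition osimplex m (c : 'I_m.+1 -> V) : set V :=
  [set x | exists l : 'I_m.+1 -> R,
     [/\ forall i, 0 < l i, \sum_i l i = 1 & x = \sum_i l i *: c i]].

Definition csimplex m (c : 'I_m.+1 -> V) : set V :=
  [set x | exists l : 'I_m.+1 -> R,
     [/\ forall i, 0 <= l i, \sum_i l i = 1 & x = \sum_i l i *: c i]].

(* vertices of the facet opposite to vertex k *)
Definition face m (c : 'I_m.+2 -> V) (k : 'I_m.+2) : 'I_m.+1 -> V :=
  fun j => c (lift k j).

(* boundary of the simplex relative to its affine span *)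
Definition sbd m (c : 'I_m.+2 -> V) : set V :=
  \bigcup_(k in [set: 'I_m.+2]) csimplex (face c k).

Definition edge_mx m (c : 'I_m.+1 -> V) : 'M[R]_(m, d.+1) :=
  \matrix_(i < m) (c (lift ord0 i) - c ord0).

(* Integral of f over {s in R^m | s_i >= 0, s_1 + ... + s_m <= r}, written as an
   iterated Lebesgue integral. *)
Fixpoint std_simplex_int (m : nat) : R -> ('rV[R]_m -> R) -> R :=
  match m with
  | 0 => fun _ f => f 0
  | m'.+1 => fun r f =>
      \int[lebesgue_measure]_(s in `[0, r])
        std_simplex_int (r - s)
          (fun u : 'rV[R]_m' => f (row_mx (s%:M : 'rV[R]_1) u))
  end.

(* Surface integral over the m-simplex c, by the affine parametrization
   s |-> c_0 + sum_j s_j (c_j - c_0), with its Gram factor. *)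
Definition surface_int m (c : 'I_m.+1 -> V) (f : V -> R) : R :=
  Num.sqrt (\det (edge_mx c *m (edge_mx c)^T)) *
  std_simplex_int 1 (fun s : 'rV[R]_m => f (c ord0 + s *m edge_mx c)).

Definition surface_area m (c : 'I_m.+1 -> V) : R := surface_int c (fun=> 1).

End Simplices.

Section Mesh.
Variables (R : realType) (d : nat).
Local Notation V := 'rV[R]_d.+1.
Local Notation element := ('I_d.+2 -> V).

(* The last condition is conformity: two closed elements meet in the (possibly
   empty) simplex spanned by their common vertices. *)
Record triangulation (Omega : set V) (Th : set element) : Prop := {
  triangulation_finite : finite_set Th;
  triangulation_nondegenerate : forall T, Th T -> edge_mx T \in unitmx;
  triangulation_cover : \bigcup_(T in Th) csimplex T = closure Omega;
  triangulation_disjoint : forall T T', Th T -> Th T' -> T <> T' ->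
    osimplex T `&` osimplex T' = set0;
  triangulation_conforming : forall T T', Th T -> Th T' ->
    csimplex T `&` csimplex T' =
    [set x | exists l : 'I_d.+2 -> R,
       [/\ forall i, 0 <= l i, \sum_i l i = 1, x = \sum_i l i *: T i &
           forall i, l i != 0 -> range T' (T i)]] }.

Definition mesh_diam (T : element) : R := ediam (osimplex T).

Definition shape_regular (I : Type) (Th : I -> set element) : Prop :=
  exists2 sigma : R, 0 < sigma & forall h T, Th h T ->
    exists x, forall y, enorm (y - x) < sigma * mesh_diam T -> osimplex T y.

Definition interface_element (Gamma : set V) (Th : set element) (T : element) :
  Prop := Th T /\ (osimplex T `&` Gamma) !=set0.

(* Gamma meets the boundary of the triangle c in exactly two points, lying on
   different (open) edges. *)
Definition cuts_two_edges (Gamma : set V) (c : 'I_3 -> V) : Prop :=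
  exists (p q : V) (k l : 'I_3),
    [/\ p <> q, k != l, osimplex (face c k) p, osimplex (face c l) q &
        Gamma `&` sbd c = [set p; q]].

Definition closed_curve (A : set V) : Prop :=
  exists gamma : R -> V,
    [/\ {within `[0, 1], continuous gamma}, gamma 0 = gamma 1,
        {in `[0, 1[ &, injective gamma} & A = gamma @` `[0, 1]].

(* The 2-dimensional subsimplices T \o e of an element T are T itself if N = 2
   and the faces of T if N = 3. *)
Definition interface_resolved (Gamma : set V) (Th : set element) : Prop :=
  (forall T (e : 'I_3 -> 'I_d.+2), Th T -> injective e ->
     (osimplex (T \o e) `&` Gamma) !=set0 -> cuts_two_edges Gamma (T \o e)) /\
  (d.+1 = 3%N -> forall T, interface_element Gamma Th T ->
     closed_curve (Gamma `&` sbd T)).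

End Mesh.

Section ApproximatingPlane.
Variables (R : realType) (d : nat).
Local Notation V := 'rV[R]_d.+1.
Local Notation element := ('I_d.+2 -> V).

Definition plane (x0 nT : V) : set V := [set x | dot (x - x0) nT = 0].

(* The constant C is uniform over the whole mesh family. *)
Definition approximating_planes (Gamma : set V) (n : V -> V) (I : Type)
    (Th : I -> set element) (x0 nT : I -> element -> V) : Prop :=
  exists C : R, forall h T, interface_element Gamma (Th h) T ->
    [/\ enorm (nT h T) = 1,
        forall k, (plane (x0 h T) (nT h T) `&` osimplex (face T k)) !=set0 <->
                  (Gamma `&` osimplex (face T k)) !=set0 &
        exists xt : V,
          [/\ Gamma xt, osimplex T xt,
              forall v, dot v (nT h T) = 0 -> dot (xt - x0 h T) v = 0 &
              enorm (x0 h T - xt) + mesh_diam T * enorm (nT h T - n xt)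
                <= C * mesh_diam T ^+ 2]].

Definition tangent_frame (nT : V) (t : 'I_d -> V) : Prop :=
  (forall i j, dot (t i) (t j) = (i == j)%:R) /\ forall i, dot (t i) nT = 0.

Variables (T : element) (x0 nT : V).

Definition Thp : set V := osimplex T `&` [set x | 0 < dot (x - x0) nT].
Definition Thm : set V := osimplex T `&` [set x | dot (x - x0) nT < 0].

Variables (mu : R) (t : 'I_d -> V).

Definition S_T : set V :=
  [set x | exists z : 'I_d -> R,
     (forall i, 0 <= z i <= mu * mesh_diam T) /\
     x = x0 + \sum_i z i *: t i].

(* the points \bar x_i, with \bar x_0 at index 0 *)
Definition xbar (j : 'I_d.+1) : V :=
  if unlift ord0 j is Some i then x0 + (mu * mesh_diam T) *: t i else x0.

Variable Gamma : set V.

(* Smallest in absolute value: the line through x along nT meets the closed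
   hypersurface Gamma again far from x, and the nearest point is meant. *)
Definition smallest_shift (x : V) : set R :=
  [set r | Gamma (x + r *: nT) /\
           forall r', Gamma (x + r' *: nT) -> `|r| <= `|r'|].

Definition projection_well_defined : Prop :=
  forall x, S_T x -> exists! r, smallest_shift x r.

Definition projection (x : V) : V := x + xget 0 (smallest_shift x) *: nT.

Variables Bp Bm : V -> 'M[R]_d.+1.

Definition flux (M : 'M[R]_d.+1) (f : V -> R) : R :=
  dot (grad f x0 *m M^T) nT.

(* J_i, i = 0 .. N; the flux jump is J_N.  The gradient of an affine function is
   constant, so the point at which [flux] evaluates it is immaterial. *)
Definition J (i : 'I_d.+2) (phi : (V -> R) * (V -> R)) : R :=
  if unlift ord_max i is Some j then phi.1 (xbar j) - phi.2 (xbar j)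
  else flux (Bp (projection x0)) phi.1 - flux (Bm (projection x0)) phi.2.

(* M_F for the face F opposite to vertex k *)
Definition M (k : 'I_d.+2) (phi : (V -> R) * (V -> R)) : R :=
  let F := osimplex (face T k) in
  (surface_area (face T k))^-1 *
  (surface_int (face T k) (fun x => \1_(F `&` boundary Thp) x * phi.1 x) +
   surface_int (face T k) (fun x => \1_(F `&` boundary Thm) x * phi.2 x)).

End ApproximatingPlane.

(* Main.v *)
Require Import Defs.
From HB Require Import structures.
From mathcomp Require Import all_boot all_order all_algebra.
From mathcomp Require Import all_classical all_reals all_analysis.
From mathcomp Require Import measurable_realfun ring lra.

Set Implicit Arguments.
Unset Strict Implicit.
Unset Printing Implicit Defensive.

Import Order.TTheory GRing.Theory Num.Theory.
Import numFieldNormedType.Exports.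

Local Open Scope classical_set_scope.
Local Open Scope ring_scope.

(** Both sides of the problem have dimension 2N+2, so it is enough to show that
    a pair of affine functions (phi+, phi-) annihilated by all the functionals
    is zero.

    Let delta(x) = (x - x0).n, where n is the unit normal of the plane L.  The
    N point conditions on L make phi+ - phi- vanish on L, so
    phi+ = phi- + c delta for some real c (tangent_decomposition).  Up to a
    null set of each face the pair then glues to the single continuous function
    phi- + c max(delta, 0), whose means over all faces vanish
    (cutoff_int_sum, M_cutoffE).

    The heart of the argument is the interpolation of max(delta, 0) by its face
    means mu_k.  By the divergence theorem, the gradient of the Crouzeix-Raviart
    interpolant of a function is the mean over T of the gradient of that
    function.  For max(delta, 0) this is theta n, where theta in [0, 1] is the
    fraction of the volume of T on the positive side of L, whatever the angles
    of T.  Expressed by the vertex values delta_k, this reads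
        N (mu_k - mu_l) = theta (delta_l - delta_k)      for all k, l,
    where k and l are also the indices of the opposite faces
    (face_pos_int_slope).  It is obtained here without the divergence theorem.
    The points (delta_k, mu_k) are collinear because the face integrals are
    divided differences of an iterated antiderivative of max(x, 0); the common
    slope has the right sign and size because max(x, 0) is nondecreasing and
    1-Lipschitz (pos_int_slope).

    Since the mean of phi- over face k is -c mu_k, the identity shows that
    phi- + c theta delta takes the same value at all vertices.  Hence
    grad phi- = - c theta n and grad phi+ = c (1 - theta) n, and the flux
    condition becomes
        c ((1 - theta) B+n.n + theta B-n.n) = 0.
    The coefficients are uniformly elliptic on both sides up to the interface
    (interface_elliptic), so the bracket is positive and c = 0.  Then phi- is a
    constant with zero mean, and the pair vanishes (kernel_trivial). *)

(** * Iterated integrals over the standard simplex *)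

Section SimplexIntegral.
Variable R : realType.
Local Notation leb := (@lebesgue_measure R).

Definition scons m (s : R) (u : 'rV[R]_m) : 'rV[R]_m.+1 := row_mx (s%:M : 'rV_1) u.

Lemma scons0 m s (u : 'rV[R]_m) : scons s u 0 ord0 = s.
Proof.
transitivity (row_mx (s%:M : 'rV_1) u 0 (lshift m (ord0 : 'I_1))).
  by congr (row_mx _ _ _ _); exact: val_inj.
by rewrite row_mxEl mxE eqxx.
Qed.

Lemma sconsS m s (u : 'rV[R]_m) i : scons s u 0 (lift ord0 i) = u 0 i.
Proof.
transitivity (row_mx (s%:M : 'rV_1) u 0 (rshift 1 i)); last by rewrite row_mxEr.
by congr (row_mx _ _ _ _); exact: val_inj.
Qed.

(** Integrability at every stage of the iterated integral; the integral of a
    sum splits only under this condition. *)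
Fixpoint std_simplex_integrable (m : nat) : R -> ('rV[R]_m -> R) -> Prop :=
  match m with
  | 0 => fun _ _ => True
  | m'.+1 => fun r f =>
      (forall s, s \in `[0, r] ->
         std_simplex_integrable (r - s) (fun u : 'rV[R]_m' => f (scons s u))) /\
      leb.-integrable `[0, r]
        (EFin \o fun s => std_simplex_int (r - s) (fun u : 'rV[R]_m' => f (scons s u)))
  end.

Lemma std_simplex_intS m r (f : 'rV[R]_m.+1 -> R) :
  std_simplex_int r f =
  \int[leb]_(s in `[0, r]) std_simplex_int (r - s) (fun u => f (scons s u)).
Proof. by []. Qed.

Lemma std_simplex_int_lin m r (a : R) (f g : 'rV[R]_m -> R) :
  std_simplex_integrable r f -> std_simplex_integrable r g ->
  std_simplex_integrable r (fun v => a * f v + g v) /\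
  std_simplex_int r (fun v => a * f v + g v) =
    a * std_simplex_int r f + std_simplex_int r g.
Proof.
elim: m r f g => [//|m IH] r f g [f1 f2] [g1 g2].
pose F s := std_simplex_int (r - s) (fun u => f (scons s u)).
pose G s := std_simplex_int (r - s) (fun u => g (scons s u)).
have E s : s \in `[0, r] ->
    std_simplex_int (r - s) (fun u => a * f (scons s u) + g (scons s u)) =
    a * F s + G s.
  by move=> sr; have [] := IH (r - s) _ _ (f1 s sr) (g1 s sr).
have iaF : leb.-integrable `[0, r] (EFin \o (fun s => a * F s)).
  rewrite (_ : EFin \o _ = fun s => (a%:E * (EFin \o F) s)%E) //.
  exact: integrableZl.
split; first split.
- by move=> s sr; have [] := IH (r - s) _ _ (f1 s sr) (g1 s sr).
- have aFG : leb.-integrable `[0, r] ((fun s => (a * F s)%R%:E) \+ (fun s => (G s)%:E))%E.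
    exact: integrableD.
  apply: eq_integrable aFG => //.
  by move=> s /[!inE] /= sr; rewrite E.
- rewrite !std_simplex_intS; under eq_Rintegral => s sr.
    rewrite E; last by move: sr; rewrite inE.
    over.
  by rewrite RintegralD// RintegralZl.
Qed.

Definition in_std_simplex m (r : R) (v : 'rV[R]_m) :=
  (forall i, 0 <= v 0 i) /\ \sum_i v 0 i <= r.

Lemma in_std_simplexS m r s (u : 'rV[R]_m) : s \in `[0, r] ->
  in_std_simplex (r - s) u -> in_std_simplex r (scons s u).
Proof.
rewrite in_itv/= => /andP[s0 _] [u0 us]; split.
  by move=> i; case: (unliftP ord0 i) => [j|] ->; rewrite ?scons0 ?sconsS.
rewrite big_ord_recl scons0 -lerBrDl.
by under eq_bigr do rewrite sconsS.
Qed.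

Lemma eq_std_simplex_int m r (f g : 'rV[R]_m -> R) : 0 <= r ->
  (forall v, in_std_simplex r v -> f v = g v) ->
  std_simplex_int r f = std_simplex_int r g.
Proof.
elim: m r f g => [|m IH] r f g r0 fg.
  by apply: fg; split=> [[]//|]; rewrite big_ord0.
rewrite !std_simplex_intS; apply: eq_Rintegral => s; rewrite inE/= => sr.
apply: IH.
  by move: sr; rewrite in_itv/= subr_ge0 => /andP[].
by move=> u us; apply: fg; exact: in_std_simplexS.
Qed.

Lemma le_std_simplex_int m r (f g : 'rV[R]_m -> R) : 0 <= r ->
  std_simplex_integrable r f -> std_simplex_integrable r g ->
  (forall v, in_std_simplex r v -> f v <= g v) ->
  std_simplex_int r f <= std_simplex_int r g.
Proof.
elim: m r f g => [|m IH] r f g r0.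
  by move=> _ _; apply; split=> [[]//|]; rewrite big_ord0.
move=> [f1 f2] [g1 g2] fg; rewrite !std_simplex_intS; apply: le_Rintegral => //.
move=> s sr; apply: IH; [|exact: f1|exact: g1|].
  by move: sr; rewrite /= in_itv/= subr_ge0 => /andP[].
by move=> u us; apply: fg; exact: in_std_simplexS.
Qed.

Definition aform m (e : R) (b : 'I_m -> R) (v : 'rV[R]_m) : R :=
  e + \sum_i b i * v 0 i.

Lemma aform_scons m e (b : 'I_m.+1 -> R) s u :
  aform e b (scons s u) = aform (e + b ord0 * s) (b \o lift ord0) u.
Proof.
rewrite /aform big_ord_recl scons0 addrA; congr (_ + _).
by apply: eq_bigr => i _; rewrite sconsS.
Qed.

(** A function with finite support is measurable whatever its values: the
    preimage of a set is finite or cofinite. *)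
Lemma Rintegral_finite_support (D A : set R) (f : R -> R) :
  finite_set A -> (forall x, D x -> f x != 0 -> A x) ->
  \int[leb]_(x in D) f x = 0.
Proof.
move=> finA fA; rewrite Rintegral_mkcond.
have {fA} : forall x, (f \_ D) x != 0 -> A x.
  by move=> x; rewrite patchE; case: ifPn => [/set_mem/fA//|_]; rewrite eqxx.
move: (f \_ D) => g gA.
have finm (Y : set R) : finite_set Y -> measurable Y.
  by move=> fY; apply: countable_measurable => //; exact: finite_set_countable.
have mg : measurable_fun setT g.
  move=> _ Y mY; rewrite setTI.
  have [Y0|Y0] := pselect (Y 0).
    rewrite -[X in measurable X]setCK; apply: measurableC; apply: finm.
    apply: (sub_finite_set _ finA) => x /= nY; apply: gA; apply/eqP => gx0.
    by apply: nY; rewrite gx0.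
  apply: finm; apply: (sub_finite_set _ finA) => x /= Yx; apply: gA.
  by apply/eqP => gx0; apply: Y0; rewrite -gx0.
rewrite /Rintegral.
have -> : (\int[leb]_x (g x)%:E = \int[leb]_x (cst 0 x))%E.
  2: by rewrite integral0.
apply: ae_eq_integral => //.
- exact/measurable_EFinP.
- exists A; split; [exact: finm| |].
    by apply: countable_lebesgue_measure0; exact: finite_set_countable.
  move=> x /= /not_implyP[_ gx]; apply: gA; apply/eqP => gx0.
  by apply: gx; rewrite gx0.
Qed.

(** Finitely many hyperplanes do not contribute.  On the slice of first
    coordinate s, an equation of a hyperplane remains nontrivial unless s is
    the abscissa of a hyperplane orthogonal to the first axis, which excludes
    finitely many s only. *)
Lemma std_simplex_int_null m r (f : 'rV[R]_m -> R) (J : finType)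
    (e : J -> R) (b : J -> 'I_m -> R) : 0 <= r ->
  (forall j, e j != 0 \/ exists i, b j i != 0) ->
  (forall v, in_std_simplex r v -> f v != 0 -> exists j, aform (e j) (b j) v = 0) ->
  std_simplex_int r f = 0.
Proof.
elim: m r f e b => [|m IH] r f e b r0 eb0 fv.
  apply/eqP/negPn/negP => /= f0; have [|j] := fv 0 _ f0.
    by split=> [[]//|]; rewrite big_ord0.
  rewrite /aform big_ord0 addr0 => ej.
  by have [|[[]//]] := eb0 j; rewrite ej eqxx.
rewrite std_simplex_intS.
pose A : set R := [set` [seq - e j / b j ord0 | j : J]].
apply: (@Rintegral_finite_support _ A); first exact: finite_seq.
move=> s /= sr; apply: contra_neqP => sA.
apply: (IH _ _ (fun j => e j + b j ord0 * s) (fun j => b j \o lift ord0)).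
- by move: sr; rewrite in_itv/= subr_ge0 => /andP[].
- move=> j; have [bj0|/forallPn[i bji]] := boolP [forall i, b j (lift ord0 i) == 0].
    2: by right; exists i.
  left; apply/eqP => E.
  have [b0|b0] := eqVneq (b j ord0) 0.
    move: E; rewrite b0 mul0r addr0 => E.
    have [|[i]] := eb0 j; first by rewrite E eqxx.
    case: (unliftP ord0 i) => [k|] ->; last by rewrite b0 eqxx.
    by move/forallP: bj0 => /(_ k) ->.
  apply: sA; rewrite /A /=; apply/mapP; exists j; first by rewrite mem_enum.
  by apply: (mulfI b0); rewrite mulrCA divff// mulr1; lra.
- move=> v vr /(fv _ (in_std_simplexS sr vr))[j]; rewrite aform_scons => Ej.
  by exists j.
Qed.

End SimplexIntegral.

Section Integrability.
Variable R : realType.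
Local Notation leb := (@lebesgue_measure R).

(** Borel measurability for functions of row vectors, stated by composition
    with measurable families of coordinates; row vectors need no sigma-algebra
    for this, and the slices of [f] inherit the property. *)
Definition coord_measurable m (f : 'rV[R]_m -> R) :=
  forall dX (X : measurableType dX) (v : X -> 'rV[R]_m),
    (forall i, measurable_fun [set: X] (fun x => v x 0 i)) ->
    measurable_fun [set: X] (fun x => f (v x)).

Lemma coord_measurableM m (f g : 'rV[R]_m -> R) :
  coord_measurable f -> coord_measurable g ->
  coord_measurable (fun v => f v * g v).
Proof. by move=> mf mg dX X v mv; apply: measurable_funM; [exact: mf|exact: mg]. Qed.

Lemma coord_measurable_aform m e (b : 'I_m -> R) : coord_measurable (aform e b).
Proof.
move=> dX X v mv; apply: measurable_funD => //.
by apply: measurable_sum => i; apply: measurable_funM.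
Qed.

(** The induction integrates one more coordinate, so the radius and the
    integrand have to depend on a measurable parameter. *)
Lemma measurable_std_simplex_int m dX (X : measurableType dX) (rho : X -> R)
    (F : X -> 'rV[R]_m -> R) :
  measurable_fun [set: X] rho ->
  (forall dY (Y : measurableType dY) (p : Y -> X) (v : Y -> 'rV[R]_m),
     measurable_fun [set: Y] p ->
     (forall i, measurable_fun [set: Y] (fun y => v y 0 i)) ->
     measurable_fun [set: Y] (fun y => F (p y) (v y))) ->
  measurable_fun [set: X] (fun x => std_simplex_int (rho x) (F x)).
Proof.
elim: m dX X rho F => [|m IH] dX X rho F mrho mF.
  by apply: (mF _ _ id (fun=> 0)) => // i; under eq_fun do rewrite mxE.
pose h (z : X * R) :=
  std_simplex_int (rho z.1 - z.2) (fun u => F z.1 (scons z.2 u)).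
have mh : measurable_fun [set: X * R] h.
  apply: (IH _ _ (fun z : X * R => rho z.1 - z.2) (fun z u => F z.1 (scons z.2 u))).
    by apply: measurable_funB => //; apply: measurableT_comp mrho _.
  move=> dY Y p v mp mv.
  apply: (mF _ _ (fun y => (p y).1) (fun y => scons (p y).2 (v y))).
    exact: measurableT_comp measurable_fst mp.
  move=> i; case: (unliftP ord0 i) => [j|] ->.
    under eq_fun do rewrite sconsS; exact: mv.
  under eq_fun do rewrite scons0.
  exact: measurableT_comp measurable_snd mp.
pose k (z : X * R) := if (0 <= z.2) && (z.2 <= rho z.1) then h z else 0.
have mk : measurable_fun [set: X * R] k.
  apply: measurable_fun_ifT => //.
  apply: measurable_and; apply: measurable_fun_ler => //.
  exact: measurableT_comp mrho _.
have mkE : measurable_fun [set: X * R] (EFin \o k) by exact/measurable_EFinP.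
(* Tonelli applies to the positive and the negative part separately, so that
   measurability in the parameter holds without integrability. *)
have E x : std_simplex_int (rho x) (F x) =
    fine (\int[leb]_s (EFin \o k)^\+ (x, s) - \int[leb]_s (EFin \o k)^\- (x, s)).
  rewrite std_simplex_intS Rintegral_mkcond /Rintegral; congr fine.
  rewrite (_ : (fun s => _) = fun s => (EFin \o k) (x, s)); last first.
    apply/funext => s; rewrite /k /= patchE /=.
    rewrite (_ : (s \in _) = (0 <= s) && (s <= rho x)) //; last first.
      by rewrite mem_setE in_itv.
  rewrite [LHS]integralE.
  under eq_integral do rewrite funepos_comp/=.
  by under [X in (_ - X)%E = _]eq_integral do rewrite funeneg_comp/=.
under eq_fun do rewrite E.
apply: measurableT_comp => //; apply: emeasurable_funB.
- apply: measurable_fun_fubini_tonelli_F => //; exact: measurable_funepos.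
- apply: measurable_fun_fubini_tonelli_F => //; exact: measurable_funeneg.
Qed.

Lemma bounded_std_simplex_integrable m r (C : R) (f : 'rV[R]_m -> R) :
  0 <= r <= 1 -> coord_measurable f ->
  (forall v, in_std_simplex r v -> `|f v| <= C) ->
  std_simplex_integrable r f /\ `|std_simplex_int r f| <= C.
Proof.
elim: m r f => [|m IH] r f /andP[r0 r1] mf fC.
  by split=> //; apply: fC; split=> [[]//|]; rewrite big_ord0.
have mfs s : coord_measurable (fun u => f (scons s u)).
  move=> dX X v mv; apply: mf => i; case: (unliftP ord0 i) => [j|] ->.
    by under eq_fun do rewrite sconsS; exact: mv.
  under eq_fun do rewrite scons0.
  exact: measurable_cst.
have I s : s \in `[0, r] ->
    std_simplex_integrable (r - s) (fun u => f (scons s u)) /\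
    `|std_simplex_int (r - s) (fun u => f (scons s u))| <= C.
  move=> sr; apply: IH => //.
    by move: sr; rewrite in_itv/= => /andP[s0 sr]; apply/andP; split; lra.
  by move=> u us; apply: fC; exact: in_std_simplexS.
have mF : measurable_fun [set: R]
    (fun s => std_simplex_int (r - s) (fun u => f (scons s u))).
  apply: (@measurable_std_simplex_int m _ R (fun s => r - s) (fun s u => f (scons s u))).
    exact: measurable_funB.
  move=> dY Y p v mp mv; apply: (mf _ _ (fun y => scons (p y) (v y))) => i.
  case: (unliftP ord0 i) => [j|] ->.
    by under eq_fun do rewrite sconsS; exact: mv.
  under eq_fun do rewrite scons0.
  exact: mp.
have iF : leb.-integrable `[0, r]
    (EFin \o fun s => std_simplex_int (r - s) (fun u => f (scons s u))).
  apply: measurable_bounded_integrable => //.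
  - by rewrite /= lebesgue_measure_itv /=; case: ifP => _; rewrite ?ltry.
  - exact: measurable_funS mF.
  - exists C; split; first exact: num_real.
    by move=> M CM s sr; apply: le_trans (ltW CM); exact: (I s sr).2.
split; first by split=> // s /I[].
have C0 : 0 <= C.
  by apply: le_trans (I 0 _).2; rewrite // in_itv/= lexx.
rewrite std_simplex_intS; apply: le_trans (le_normr_Rintegral _ iF) _ => //.
apply: (@le_trans _ _ (\int[leb]_(s in `[0, r]) C)).
  apply: le_Rintegral => //.
  - by have := integrable_norm iF.
  - apply: measurable_bounded_integrable => //.
      by rewrite /= lebesgue_measure_itv /=; case: ifP => _; rewrite ?ltry.
    exists C; split; first exact: num_real.
    by move=> M CM s _ /=; rewrite ger0_norm// ltW.
  - by move=> s sr; exact: (I s sr).2.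
rewrite Rintegral_cst//= lebesgue_measure_itv /= lte_fin.
case: ifP => _ /=; last by rewrite mulr0.
by rewrite subr0 ler_piMr.
Qed.

Lemma Rintegral_FTC (f F : R -> R) (a b : R) : a <= b -> continuous f ->
  (forall x : R, is_derive x 1 F (f x)) ->
  \int[leb]_(x in `[a, b]) f x = F b - F a.
Proof.
rewrite le_eqVlt => /predU1P[<-|ab] cf dF.
  by rewrite set_itv1 Rintegral_set1 subrr.
have cF : continuous F.
  by move=> x; apply/differentiable_continuous/derivable1_diffP; case: (dF x).
rewrite /Rintegral (continuous_FTC2 ab (F := F)) //.
- by apply: continuous_subspaceT.
- split.
  + by move=> x _; case: (dF x).
  + exact/cvg_at_right_filter/cF.
  + exact/cvg_at_left_filter/cF.
- by move=> x _; rewrite derive1E; case: (dF x).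
Qed.

End Integrability.

Section AffineIntegral.
Variable R : realType.
Local Notation leb := (@lebesgue_measure R).

(** The slices are affine again, and one integration amounts to the
    antiderivative of a polynomial in the first coordinate. *)
Lemma std_simplex_int_aform m (r e : R) (b : 'I_m -> R) : 0 <= r ->
  std_simplex_int r (aform e b) =
  r ^+ m / m`!%:R * e + r ^+ m.+1 / m.+1`!%:R * \sum_i b i.
Proof.
elim: m r e b => [|m IH] r e b r0.
  by rewrite /= /aform !big_ord0 mulr0 !addr0 expr0 divr1 mul1r.
rewrite std_simplex_intS big_ord_recl.
set B := \sum_i b (lift ord0 i).
transitivity (\int[leb]_(s in `[0, r])
    ((r - s) ^+ m / m`!%:R * (e + b ord0 * s) + (r - s) ^+ m.+1 / m.+1`!%:R * B)).
  apply: eq_Rintegral => s; rewrite inE/= in_itv/= => /andP[s0 sr].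
  rewrite (@eq_std_simplex_int _ _ _ _ (aform (e + b ord0 * s) (b \o lift ord0))).
  - by rewrite IH ?subr_ge0.
  - by rewrite subr_ge0.
  - by move=> u _; exact: aform_scons.
have factV k : (k`!%:R)^-1 = k.+1%:R * (k.+1`!%:R)^-1 :> R.
  have nz : k`!%:R != 0 :> R by rewrite pnatr_eq0 -lt0n fact_gt0.
  by rewrite factS natrM invfM mulrA divff ?pnatr_eq0// mul1r.
have := factV m; have := factV m.+1.
move: (m`!%:R^-1) (m.+1`!%:R^-1) (m.+2`!%:R^-1) => c0 c1 c2 E1 E0.
have [L LE dL] : exists2 L : {poly R}, (forall s, L.[s] = r - s) & L^`() = - 1.
  exists (r%:P - 'X) => [s|]; first by rewrite !hornerE.
  by rewrite derivB derivC derivX sub0r.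
(* An antiderivative obtained by parts; it vanishes at s = r because both terms
   carry a power of L = r - X. *)
pose P : {poly R} := - (L ^+ m.+1 * (c1%:P * (e%:P + (b ord0)%:P * 'X)) +
                        (c2 * (b ord0 + B)) *: L ^+ m.+2).
have dLX n : (L ^+ n.+1)^`() = - (n.+1%:R *: L ^+ n).
  by rewrite deriv_exp dL mulN1r scaler_nat mulNrn.
transitivity (\int[leb]_(s in `[0, r]) P^`().[s]).
  apply: eq_Rintegral => s _.
  rewrite /P derivN derivD derivZ derivM !dLX derivM derivD derivM !derivC derivX.
  rewrite !mul0r !add0r mulr1.
  rewrite !(hornerE, horner_exp) !LE E0 E1 (exprS _ m).
  by move: ((r - s) ^+ m) => z /=; ring.
rewrite (Rintegral_FTC r0 (@continuous_horner _ P^`()) (is_derive_poly P)).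
have -> : P.[r] = 0.
  by rewrite /P !(hornerE, horner_exp) !LE subrr !expr0n /= !(mul0r, mulr0, addr0, oppr0).
rewrite sub0r /P !(hornerE, horner_exp) !LE subr0 opprK.
rewrite (exprS r m.+1) -[LHS]/(r ^+ m.+1 * c1 * e + c2 * (b ord0 + B) * r * r ^+ m.+1).
by move: (r ^+ m.+1) => z; ring.
Qed.

End AffineIntegral.

(** * Integrals of the positive part of an affine function *)

Section PositivePart.
Variable R : realType.
Local Notation leb := (@lebesgue_measure R).

Definition pos_part (x : R) : R := Num.max x 0.
Definition pos_part_prim (x : R) : R := pos_part x ^+ 2 / 2.

Lemma pos_partP (x : R) : (0 <= x /\ pos_part x = x) \/ (x <= 0 /\ pos_part x = 0).
Proof. by rewrite /pos_part; case: (leP x 0) => x0; [right|left; rewrite ltW]. Qed.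

Lemma pos_part_slope (x y : R) : x <= y -> 0 <= pos_part y - pos_part x <= y - x.
Proof. by move=> xy; case: (pos_partP x) => -[? ->]; case: (pos_partP y) => -[? ->]; lra. Qed.

Lemma continuous_pos_part : continuous pos_part.
Proof. by move=> x; apply: continuous_max; [exact: cvg_id|exact: cvg_cst]. Qed.

(** At 0 the two formulas have to be glued: the remainder of order one is at most
    h^2/2 on both sides because [pos_part] is 1-Lipschitz. *)
Lemma is_derive_pos_part_prim (x : R) : is_derive x 1 pos_part_prim (pos_part x).
Proof.
have E (h : R) : `|pos_part_prim (h + x) - pos_part_prim x - h * pos_part x| <= h ^+ 2 / 2.
  rewrite ler_norml /pos_part_prim.
  by case: (pos_partP x) => -[? ->]; case: (pos_partP (h + x)) => -[? ->];
    apply/andP; split; nra.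
have C : h^-1 *: (pos_part_prim (h *: 1 + x) - pos_part_prim x) @[h --> (0 : R)^'] --> pos_part x.
  apply/cvgrPdist_le => e e0; near=> h.
  have h0 : h != 0 by near: h; exact: nbhs_dnbhs_neq.
  have he : `|h| <= e by near: h; apply: dnbhs0_le.
  rewrite [h *: 1]mulr1 -[_ *: _]/(h^-1 * _).
  have -> : pos_part x - h^-1 * (pos_part_prim (h + x) - pos_part_prim x) =
            - (h^-1 * (pos_part_prim (h + x) - pos_part_prim x - h * pos_part x)) by field.
  rewrite normrN normrM normfV ler_pdivrMl ?normr_gt0//.
  apply: le_trans (E h) _; rewrite -real_normK ?num_real//.
  have := normr_ge0 h; nra.
apply: DeriveDef; first by apply/cvg_ex; exists (pos_part x).
exact: cvg_lim C.
Unshelve. all: by end_near.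
Qed.

Lemma continuous_pos_part_prim : continuous pos_part_prim.
Proof.
move=> x; apply/differentiable_continuous/derivable1_diffP.
by case: (is_derive_pos_part_prim x).
Qed.

Lemma continuous_affine (f : R -> R) (a k : R) : continuous f ->
  continuous (fun s : R => f (a + s * k)).
Proof.
move=> cf s; apply: (@continuous_comp R R R (fun s : R => a + s * k)); last exact: cf.
by apply: cvgD; [exact: cvg_cst|apply: cvgM; [exact: cvg_id|exact: cvg_cst]].
Qed.

Lemma integrable_continuous (f : R -> R) (a b : R) : continuous f ->
  leb.-integrable `[a, b] (EFin \o f).
Proof.
move=> cf; apply: continuous_compact_integrable; first exact: segment_compact.
exact: continuous_subspaceT.
Qed.

Lemma Rintegral_pos_part_affine (a k r : R) : 0 <= r ->
  (\int[leb]_(s in `[0, r]) pos_part (a + s * k)) * k = pos_part_prim (a + r * k) - pos_part_prim a.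
Proof.
move=> r0; have cp : continuous (fun s : R => pos_part (a + s * k)).
  exact: continuous_affine continuous_pos_part.
rewrite -RintegralZr//; last exact: integrable_continuous.
have d (s : R) : is_derive s 1 (fun s => pos_part_prim (a + s * k)) (pos_part (a + s * k) * k).
  have da : is_derive s (1 : R) (fun s => a + s * k) k.
    have := is_derive_poly (a%:P + k *: 'X) s.
    rewrite derivD derivC add0r derivZ derivX hornerZ hornerC mulr1.
    by congr is_derive; apply/funext => x; rewrite !hornerE mulrC.
  have := is_derive_pos_part_prim (a + s * k) => dp.
  have := @is_derive1_comp _ pos_part_prim (fun s => a + s * k) s _ _ dp da.
  by move=> dc; apply: (is_derive_eq dc); rewrite mulrC.
rewrite (Rintegral_FTC r0 _ d) ?mul0r ?addr0//.
by move=> s; apply: cvgM; [exact: cp|exact: cvg_cst].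
Qed.

End PositivePart.

Section Triangle.
Variable R : realType.
Local Notation leb := (@lebesgue_measure R).

(** The extension of g by 0 outside the triangle is bounded with support in the
    unit square, hence integrable on the plane, where Fubini applies. *)
Lemma triangle_fubini (g : R * R -> R) (C : R) :
  measurable_fun [set: R * R] g ->
  (forall s u, 0 <= s -> 0 <= u -> s + u <= 1 -> `|g (s, u)| <= C) ->
  \int[leb]_(s in `[0, 1]) (\int[leb]_(u in `[0, 1 - s]) g (s, u)) =
  \int[leb]_(u in `[0, 1]) (\int[leb]_(s in `[0, 1 - u]) g (s, u)).
Proof.
move=> mg gC.
pose D (z : R * R) := [&& 0 <= z.1, 0 <= z.2 & z.1 + z.2 <= 1].
pose k (z : R * R) := if D z then g z else 0.
have mk : measurable_fun [set: R * R] k.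
  apply: measurable_fun_ifT => //.
  apply: measurable_and; first exact: measurable_fun_ler.
  apply: measurable_and; first exact: measurable_fun_ler.
  by apply: measurable_fun_ler => //; exact: measurable_funD.
pose Q := `[0, 1]%classic `*` `[0, 1]%classic : set (R * R).
have mQ : measurable Q by exact: measurableX.
have Qfin : ((leb \x leb) Q < +oo)%E.
  rewrite product_measure1E//= !lebesgue_measure_itv /= lte_fin ltr01.
  by rewrite sube0 mule1 ltry.
have ik : (leb \x leb)%E.-integrable [set: R * R] (EFin \o k).
  have -> : EFin \o k = (EFin \o k) \_ Q.
    apply/funext => -[s u]; rewrite patchE; case: ifPn => // /negP sQ /=.
    rewrite /k /D /=; case: ifPn => // /and3P[s0 u0 su]; exfalso; apply: sQ.
    by rewrite inE /Q /= !in_itv/=; split; apply/andP; split; lra.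
  apply: (@integrable_mkcond _ _ R (leb \x leb)%E Q (EFin \o k) mQ).1.
  apply: measurable_bounded_integrable => //.
    exact: measurable_funS mk.
  exists C; split; first exact: num_real.
  move=> M CM [s u] _ /=; apply: le_trans (ltW CM).
  rewrite /k /D /=; case: ifPn => [/and3P[s0 u0 su]|_]; first exact: gC.
  by rewrite normr0; apply: le_trans (gC 0 0 _ _ _); rewrite ?addr0.
have fubini := Fubini ik.
have kC z : `|k z| <= C.
  case: z => s u; rewrite /k /D /=; case: ifPn => [/and3P[s0 u0 su]|_]; first exact: gC.
  by rewrite normr0; apply: le_trans (gC 0 0 _ _ _); rewrite ?addr0.
have inner (f h : R -> R) (r : R) : measurable_fun [set: R] h ->
    (forall u, `|h u| <= C) -> f \_ `[0, r] =1 h ->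
    (\int[leb]_u (h u)%:E = (\int[leb]_(u in `[0, r]) f u)%:E)%E.
  move=> mh hC fh; have E : f \_ `[0, r] = h by exact/funext.
  rewrite Rintegral_mkcond E /Rintegral fineK//; apply: integrable_fin_num => //.
  rewrite (_ : (fun u => _) = (EFin \o h) \_ `[0, r]).
    apply: (@integrable_mkcond _ _ R leb `[0, r]%classic (EFin \o h) _).1 => //.
    apply: measurable_bounded_integrable => //.
    - by rewrite /= lebesgue_measure_itv /=; case: ifP => _; rewrite ?ltry.
    - exact: measurable_funS mh.
    - exists C; split; first exact: num_real.
      by move=> M CM u _ /=; apply: le_trans (ltW CM).
  apply/funext => u; rewrite patchE; case: ifPn => //= uD.
  by rewrite -E patchE (negbTE uD).
have E1 (s : R) : (\int[leb]_u (k (s, u))%:E)%E =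
   (((fun s => \int[leb]_(u in `[0, 1 - s]) g (s, u)) \_ `[0, 1]) s)%:E.
  rewrite patchE; case: ifPn => [|/negP] sI.
    apply: (inner (fun u => g (s, u)) (fun u => k (s, u))) => //.
      exact: measurableT_comp mk (measurable_pair1 _).
    move=> u; rewrite /k /D /= patchE mem_setE in_itv /= lerBrDl.
    by move: sI; rewrite inE /= in_itv /= => /andP[-> _].
  rewrite -[0%:E in RHS](integral0 leb setT); apply: eq_integral => u _; congr EFin.
  rewrite /k /D /=; case: ifPn => // /and3P[s0 u0 su]; exfalso; apply: sI.
  by rewrite inE /= in_itv /=; apply/andP; split; lra.
have E2 (u : R) : (\int[leb]_s (k (s, u))%:E)%E =
   (((fun u => \int[leb]_(s in `[0, 1 - u]) g (s, u)) \_ `[0, 1]) u)%:E.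
  rewrite patchE; case: ifPn => [|/negP] uI.
    apply: (inner (fun s => g (s, u)) (fun s => k (s, u))) => //.
      exact: measurableT_comp mk (measurable_pair2 _).
    move=> s; rewrite /k /D /= patchE mem_setE in_itv /= lerBrDr.
    by move: uI; rewrite inE /= in_itv /= => /andP[-> _].
  rewrite -[0%:E in RHS](integral0 leb setT); apply: eq_integral => s _; congr EFin.
  rewrite /k /D /=; case: ifPn => // /and3P[s0 u0 su]; exfalso; apply: uI.
  by rewrite inE /= in_itv /=; apply/andP; split; lra.
rewrite [LHS]Rintegral_mkcond [RHS]Rintegral_mkcond /Rintegral.
under eq_integral => s _ do rewrite -E1.
under [in RHS]eq_integral => u _ do rewrite -E2.
by congr fine; exact: fubini.
Qed.

End Triangle.

Section PositivePartIntegral.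
Variable R : realType.
Local Notation leb := (@lebesgue_measure R).

(** The affine function with values [c] at the vertices of the standard
    simplex (the origin first, then the ends of the axes). *)
Definition bary m (c : 'I_m.+1 -> R) : 'rV[R]_m -> R :=
  aform (c ord0) (fun i => c (lift ord0 i) - c ord0).

Lemma aform_norm_le m r e (b : 'I_m -> R) v : r <= 1 ->
  in_std_simplex r v -> `|aform e b v| <= `|e| + \sum_i `|b i|.
Proof.
move=> r1 [v0 vr]; apply: le_trans (ler_normD _ _) _; rewrite lerD2l.
apply: le_trans (ler_norm_sum _ _ _) _; apply: ler_sum => i _.
rewrite normrM ler_piMr// ger0_norm//.
apply: le_trans (le_trans vr r1); rewrite (bigD1 i)//= lerDl.
exact: sumr_ge0.
Qed.

Lemma aform_integrable m r e (b : 'I_m -> R) : 0 <= r <= 1 ->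
  std_simplex_integrable r (aform e b).
Proof.
move=> /andP[r0 r1].
have [] // := @bounded_std_simplex_integrable R m r (`|e| + \sum_i `|b i|) (aform e b).
- by rewrite r0.
- exact: coord_measurable_aform.
- by move=> v vr; exact: aform_norm_le vr.
Qed.

Lemma pos_part_norm_le (x : R) : `|pos_part x| <= `|x|.
Proof. by case: (pos_partP x) => -[x0 ->]; rewrite ?normr0. Qed.

Lemma coord_measurable_pos_part m (f : 'rV[R]_m -> R) :
  coord_measurable f -> coord_measurable (fun v => pos_part (f v)).
Proof. by move=> mf dX X v mv; apply: measurable_maxr => //; exact: mf. Qed.

Lemma pos_part_aform_integrable m r e (b : 'I_m -> R) : 0 <= r <= 1 ->
  std_simplex_integrable r (fun v => pos_part (aform e b v)).
Proof.
move=> /andP[r0 r1].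
have [] // := @bounded_std_simplex_integrable R m r (`|e| + \sum_i `|b i|)
  (fun v => pos_part (aform e b v)).
- by rewrite r0.
- exact/coord_measurable_pos_part/coord_measurable_aform.
- by move=> v vr; apply: le_trans (pos_part_norm_le _) _; exact: aform_norm_le vr.
Qed.

(** m! times this is the mean, over a simplex with vertex values [c], of the
    positive part of the affine function. *)
Definition pos_int m (c : 'I_m.+1 -> R) : R :=
  std_simplex_int 1 (fun v => pos_part (bary c v)).

Definition segment_int (a b : R) := \int[leb]_(s in `[0, 1]) pos_part (a + s * (b - a)).
Definition triangle_int (a b c : R) := \int[leb]_(s in `[0, 1])
   (\int[leb]_(u in `[0, 1 - s]) pos_part (a + s * (b - a) + u * (c - a))).

Lemma pos_int1 (c : 'I_2 -> R) : pos_int c = segment_int (c ord0) (c (lift ord0 ord0)).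
Proof.
rewrite /pos_int std_simplex_intS; apply: eq_Rintegral => s _ /=.
by rewrite /bary aform_scons /aform big_ord0 addr0 mulrC.
Qed.

Lemma pos_int2 (c : 'I_3 -> R) :
  pos_int c = triangle_int (c ord0) (c (lift ord0 ord0)) (c (lift ord0 (lift ord0 ord0))).
Proof.
rewrite /pos_int std_simplex_intS; apply: eq_Rintegral => s _ /=.
apply: eq_Rintegral => u _ /=.
rewrite /bary !aform_scons /aform big_ord0 addr0 /=.
by rewrite [_ * s]mulrC [_ * u]mulrC.
Qed.

(** As a function of its endpoints, [segment_int] is the divided difference of
    an antiderivative of [pos_part]. *)
Lemma segment_int_slope a b : segment_int a b * (b - a) = pos_part_prim b - pos_part_prim a.
Proof. by rewrite /segment_int Rintegral_pos_part_affine// mul1r subrKC. Qed.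

Lemma segment_int_sym a b : segment_int a b = segment_int b a.
Proof.
have [->//|ab] := eqVneq a b.
have ba : b - a != 0 by rewrite subr_eq0 eq_sym.
apply: (mulIf ba); rewrite segment_int_slope -[b - a]opprB mulrN segment_int_slope; ring.
Qed.

(** The inner integral is a divided difference in the values at the vertices 0
    and 2, hence symmetric in them. *)
Lemma triangle_int_sym02 a b c : triangle_int a b c = triangle_int c b a.
Proof.
have [->//|ac] := eqVneq a c.
have ca : c - a != 0 by rewrite subr_eq0 eq_sym.
apply: eq_Rintegral => s; rewrite inE /= in_itv /= => /andP[s0 s1].
apply: (mulIf ca); rewrite Rintegral_pos_part_affine ?subr_ge0//.
rewrite -[in RHS](opprB a c) mulrN Rintegral_pos_part_affine ?subr_ge0// opprB.
congr (_ - _); congr pos_part_prim; ring.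
Qed.

Lemma triangle_int_sym12 a b c : triangle_int a b c = triangle_int a c b.
Proof.
rewrite /triangle_int (@triangle_fubini _ (fun z => pos_part (a + z.1 * (b - a) + z.2 * (c - a)))
   (`|a| + `|b - a| + `|c - a|)).
- apply: eq_Rintegral => u _; apply: eq_Rintegral => s _ /=.
  by rewrite -!addrA [X in a + X]addrC.
- apply: measurable_maxr => //; apply: measurable_funD.
    by apply: measurable_funD => //; apply: measurable_funM.
  by apply: measurable_funM.
- move=> s u s0 u0 su /=; apply: le_trans (pos_part_norm_le _) _.
  apply: le_trans (ler_normD _ _) _; apply: lerD.
    apply: le_trans (ler_normD _ _) _; rewrite lerD2l normrM ger0_norm//.
    by rewrite ler_piMl//; lra.
  by rewrite normrM ger0_norm// ler_piMl//; lra.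
Qed.

Lemma triangle_int_sym01 a b c : triangle_int a b c = triangle_int b a c.
Proof. by rewrite triangle_int_sym12 triangle_int_sym02 triangle_int_sym12. Qed.

Lemma triangle_int_inner_integrable a b c : leb.-integrable `[0, 1]
  (EFin \o fun s => \int[leb]_(u in `[0, 1 - s]) pos_part (a + s * (b - a) + u * (c - a))).
Proof.
have r01 : 0 <= (1 : R) <= 1 by rewrite ler01 lexx.
have [_] := @pos_part_aform_integrable 2 1 a (fun i => nth 0 [:: b - a; c - a] i) r01.
apply: eq_integrable => // s _ /=; congr EFin; apply: eq_Rintegral => u _.
by rewrite !aform_scons /aform big_ord0 addr0 /= [_ * s]mulrC [_ * u]mulrC.
Qed.

Definition side_int (p x : R) := \int[leb]_(s in `[0, 1]) pos_part_prim (x + s * (p - x)).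

(** The integral over a triangle with one vertex value [p] fixed is a divided
    difference in the other two; [p] occupies the middle place because the
    inner variable then runs from the edge (a, p) to the edge (b, p). *)
Lemma triangle_int_slope a p b : triangle_int a p b * (b - a) = side_int p b - side_int p a.
Proof.
have ipos2 x : leb.-integrable `[0, 1] (EFin \o fun s => pos_part_prim (x + s * (p - x))).
  by apply: integrable_continuous; apply: continuous_affine; exact: continuous_pos_part_prim.
rewrite -RintegralZr//; last exact: triangle_int_inner_integrable.
rewrite -RintegralB//; apply: eq_Rintegral => s; rewrite inE /= in_itv /= => /andP[s0 s1].
rewrite Rintegral_pos_part_affine ?subr_ge0//; congr (pos_part_prim _ - _); ring.
Qed.

Lemma baryE m (c : 'I_m.+1 -> R) (v : 'rV[R]_m) :
  bary c v = c ord0 * (1 - \sum_i v 0 i) + \sum_i c (lift ord0 i) * v 0 i.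
Proof.
rewrite /bary /aform; under eq_bigr do rewrite mulrBl.
by rewrite sumrB -mulr_sumr; ring.
Qed.

Lemma bary_int m (c : 'I_m.+1 -> R) :
  std_simplex_int 1 (bary c) = (\sum_i c i) / m.+1`!%:R.
Proof.
rewrite std_simplex_int_aform// !expr1n sumrB sumr_const card_ord big_ord_recl.
have -> : (m`!%:R)^-1 = m.+1%:R / m.+1`!%:R :> R.
  have nz : m`!%:R != 0 :> R by rewrite pnatr_eq0 -lt0n fact_gt0.
  by rewrite factS natrM invfM mulrA divff ?pnatr_eq0// mul1r.
rewrite -[_ *+ m]mulr_natl -natr1; ring.
Qed.

(** [pos_part] is nondecreasing and 1-Lipschitz, so the difference of the
    integrals lies between 0 and the integral of the difference of the two
    affine functions, which is given by [bary_int]. *)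
Lemma pos_int_slope m (c c' : 'I_m.+1 -> R) : (forall i, c i <= c' i) ->
  0 <= m.+1`!%:R * (pos_int c' - pos_int c) <= \sum_i (c' i - c i).
Proof.
move=> cc'.
have D0 v : in_std_simplex 1 v -> 0 <= bary (fun i => c' i - c i) v.
  move=> [v0 v1]; rewrite baryE; apply: addr_ge0.
    by apply: mulr_ge0; rewrite subr_ge0.
  by apply: sumr_ge0 => i _; apply: mulr_ge0; rewrite ?subr_ge0.
have E v : bary (fun i => c' i - c i) v = bary c' v - bary c v.
  rewrite !baryE; under [X in _ + X = _]eq_bigr do rewrite mulrBl.
  by rewrite sumrB; ring.
have ip d : std_simplex_integrable 1 (fun v => pos_part (@bary m d v)).
  by apply: pos_part_aform_integrable; rewrite ler01 lexx.
have ia d : std_simplex_integrable 1 (@bary m d).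
  by apply: aform_integrable; rewrite ler01 lexx.
have [i1 e1] := std_simplex_int_lin 1 (ia (fun i => c' i - c i)) (ip c).
have h1 : pos_int c <= pos_int c'.
  apply: le_std_simplex_int => // v /D0; rewrite E subr_ge0 => /pos_part_slope.
  by rewrite subr_ge0 => /andP[].
have h2 : pos_int c' <= 1 * std_simplex_int 1 (bary (fun i => c' i - c i)) + pos_int c.
  rewrite -e1; apply: le_std_simplex_int => // v /D0.
  by rewrite E subr_ge0 => /pos_part_slope/andP[_]; lra.
have f0 : 0 < m.+1`!%:R :> R by rewrite ltr0n fact_gt0.
rewrite mulr_ge0 ?subr_ge0 ?(ltW f0)//= mulrC -ler_pdivlMr//.
by rewrite -bary_int; lra.
Qed.

(** The points (x k, mu k) lie on a line, and [theta] is - k0 times its slope,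
    read off from one pair with distinct abscissas.  When all the abscissas are
    equal, the slope bound makes both sides of the conclusion vanish. *)
Lemma exists_common_slope (I : finType) (k0 : R) (x mu : I -> R) :
  (forall k l j, mu k * (x j - x l) + mu l * (x k - x j) + mu j * (x l - x k) = 0) ->
  (forall k l, x k <= x l -> 0 <= k0 * (mu k - mu l) <= x l - x k) ->
  exists2 theta, 0 <= theta <= 1 &
    forall k l, k0 * (mu k - mu l) = theta * (x l - x k).
Proof.
move=> col slope.
have [/forallP xE|/forallPn[p /forallPn[q pq]]] := boolP [forall p, forall q, x p <= x q].
  exists 0; first by rewrite lexx ler01.
  move=> k l; have := slope k l (forallP (xE k) l).
  by have := forallP (xE k) l; have := forallP (xE l) k; lra.
move: pq; rewrite -ltNge => pq.
have d0 : x p - x q != 0 by lra.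
exists (k0 * (mu q - mu p) / (x p - x q)).
  have := slope q p (ltW pq) => /andP[h1 h2].
  by rewrite divr_ge0 ?subr_ge0 ?(ltW pq)//= ler_pdivrMr ?subr_gt0// mul1r.
move=> k l; apply: (mulIf d0).
have E : (mu k - mu l) * (x p - x q) = (mu q - mu p) * (x l - x k).
  by have := col k p q; have := col l p q; lra.
rewrite -[LHS]mulrA E; field.
by rewrite d0.
Qed.

End PositivePartIntegral.

Section CommonSlope.
Variable R : realType.

Lemma segment_int_mono (a a' b : R) : a <= a' ->
  0 <= 2 * (segment_int a' b - segment_int a b) <= a' - a.
Proof.
move=> aa'; have := @pos_int_slope R 1 (fun i => nth 0 [:: a; b] i)
  (fun i => nth 0 [:: a'; b] i).
rewrite !pos_int1 (_ : 2`! = 2)%N// !big_ord_recl big_ord0 /= (subrr b) !addr0.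
apply.
by case=> [[|[|//]]] /=.
Qed.

Lemma triangle_int_mono (a a' b c : R) : a <= a' ->
  0 <= 6 * (triangle_int a' b c - triangle_int a b c) <= a' - a.
Proof.
move=> aa'; have := @pos_int_slope R 2 (fun i => nth 0 [:: a; b; c] i)
  (fun i => nth 0 [:: a'; b; c] i).
rewrite !pos_int2 (_ : 3`! = 6)%N// !big_ord_recl big_ord0 /= (subrr b) (subrr c) !addr0.
apply.
by case=> [[|[|[|//]]]] /=.
Qed.

(** [S a b] stands for the integral over an edge with end values a and b.  As
    each integral is a divided difference of one function [Q], the sums that
    express collinearity telescope. *)
Lemma common_slope_segments (S : R -> R -> R) (Q : R -> R) (y : nat -> R) :
  (forall a b, S a b = S b a) ->
  (forall a b, S a b * (b - a) = Q b - Q a) ->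
  (forall a a' b, a <= a' -> 0 <= 2 * (S a' b - S a b) <= a' - a) ->
  exists2 theta, 0 <= theta <= 1 & forall k l : 'I_3,
    let mu (n : nat) := match n with
      | 0 => S (y 1) (y 2) | 1 => S (y 0) (y 2) | _ => S (y 0) (y 1) end%N in
    2 * (mu k - mu l) = theta * (y l - y k).
Proof.
move=> S_sym S_slope S_mono.
pose mu (n : nat) := match n with
  | 0 => S (y 1) (y 2) | 1 => S (y 0) (y 2) | _ => S (y 0) (y 1) end%N.
apply: (@exists_common_slope _ 'I_3 2 y mu).
- have e01 := S_slope (y 0%N) (y 1%N).
  have e02 := S_slope (y 0%N) (y 2%N).
  have e12 := S_slope (y 1%N) (y 2%N).
  by case=> [[|[|[|//]]]] ? [[|[|[|//]]]] ? [[|[|[|//]]]] ? /=; lra.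
- have H a a' b := S_mono (y a) (y a') (y b).
  have c a b := S_sym (y a) (y b).
  case=> [[|[|[|//]]]] ? [[|[|[|//]]]] ? /= kl; try (by apply/andP; split; lra).
  + exact: H.
  + by rewrite (c 1 2)%N; exact: H.
  + exact: H.
  + by rewrite (c 0 1)%N (c 0 2)%N; exact: H.
  + by rewrite (c 1 2)%N; exact: H.
  + by rewrite (c 0 1)%N (c 0 2)%N; exact: H.
Qed.

(** [S a b c] stands for the integral over a face with vertex values a, b, c.
    Three faces of a tetrahedron share the vertex opposite to the fourth; with
    the value p at this vertex fixed, their integrals are divided differences of
    the one function [Q p], as for the edges of a triangle. *)
Lemma common_slope_triangles (S : R -> R -> R -> R) (Q : R -> R -> R) (y : nat -> R) :
  (forall a b c, S a b c = S b a c) ->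
  (forall a b c, S a b c = S a c b) ->
  (forall a p b, S a p b * (b - a) = Q p b - Q p a) ->
  (forall a a' b c, a <= a' -> 0 <= 6 * (S a' b c - S a b c) <= a' - a) ->
  exists2 theta, 0 <= theta <= 1 & forall k l : 'I_4,
    let mu (n : nat) := match n with
      | 0 => S (y 1) (y 2) (y 3) | 1 => S (y 0) (y 2) (y 3)
      | 2 => S (y 0) (y 1) (y 3) | _ => S (y 0) (y 1) (y 2) end%N in
    6 * (mu k - mu l) = theta * (y l - y k).
Proof.
move=> sym01 sym12 S_slope S_mono.
pose mu (n : nat) := match n with
  | 0 => S (y 1) (y 2) (y 3) | 1 => S (y 0) (y 2) (y 3)
  | 2 => S (y 0) (y 1) (y 3) | _ => S (y 0) (y 1) (y 2) end%N.
have s1 a b c := sym01 (y a) (y b) (y c).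
have s2 a b c := sym12 (y a) (y b) (y c).
apply: (@exists_common_slope _ 'I_4 6 y mu).
- have E a p b := S_slope (y a) (y p) (y b).
  have := (E 0 1 2, E 0 1 3, E 2 1 3, E 0 2 1, E 0 2 3, E 1 2 3,
           E 0 3 1, E 0 3 2, E 1 3 2, E 1 0 2, E 1 0 3, E 2 0 3)%N.
  rewrite (s1 1 0 2)%N (s1 1 0 3)%N (s1 2 0 3)%N (s1 2 1 3)%N.
  rewrite (s2 0 2 1)%N (s2 0 3 1)%N (s2 0 3 2)%N (s2 1 3 2)%N.
  case=> [[[[[[[[[[[e1 e2] e3] e4] e5] e6] e7] e8] e9] e10] e11] e12].
  by case=> [[|[|[|[|//]]]]] ? [[|[|[|[|//]]]]] ? [[|[|[|[|//]]]]] ? /=; lra.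
- have H a a' b c := S_mono (y a) (y a') (y b) (y c).
  have r3 a b c : S (y a) (y b) (y c) = S (y c) (y a) (y b).
    by rewrite s2 s1.
  case=> [[|[|[|[|//]]]]] ? [[|[|[|[|//]]]]] ? /= kl; try (by apply/andP; split; lra).
  + exact: H.
  + by rewrite (s1 1 2 3)%N; exact: H.
  + by rewrite (r3 1 2 3)%N; exact: H.
  + exact: H.
  + by rewrite (s1 0 2 3)%N (s1 0 1 3)%N; exact: H.
  + by rewrite (r3 0 2 3)%N (s1 0 1 2)%N; exact: H.
  + by rewrite (s1 1 2 3)%N; exact: H.
  + by rewrite (s1 0 1 3)%N (s1 0 2 3)%N; exact: H.
  + by rewrite (r3 0 1 3)%N (r3 0 1 2)%N; exact: H.
  + by rewrite (r3 1 2 3)%N; exact: H.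
  + by rewrite (s1 0 1 2)%N (r3 0 2 3)%N; exact: H.
  + by rewrite (r3 0 1 2)%N (r3 0 1 3)%N; exact: H.
Qed.

(** The identity N (mu_k - mu_l) = theta (delta_l - delta_k) between the means
    of the positive part of an affine function over the faces of a triangle or
    tetrahedron and its vertex values; [theta] plays the part of the fraction of
    the volume on which the affine function is positive. *)
Lemma face_pos_int_slope m (x : 'I_m.+2 -> R) : m = 1%N \/ m = 2%N ->
  exists2 theta, 0 <= theta <= 1 & forall k l,
    m.+1`!%:R * (pos_int (x \o lift k) - pos_int (x \o lift l)) = theta * (x l - x k).
Proof.
have [y xy] : exists y : nat -> R, forall i, x i = y (val i).
  by exists (fun n => x (inord n)) => i; rewrite inord_val.
case=> mE; subst m.
- have [th th01 E] := @common_slope_segments (@segment_int R) (@pos_part_prim R) y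
    (@segment_int_sym R) (@segment_int_slope R) segment_int_mono.
  have muE k : pos_int (x \o lift k) = match val k with
    | 0 => segment_int (y 1) (y 2)
    | 1 => segment_int (y 0) (y 2) | _ => segment_int (y 0) (y 1) end%N.
    by rewrite pos_int1 /= !xy; case: k => [[|[|[|//]]]] ki.
  exists th => // k l; rewrite !muE !xy (_ : 2`! = 2)%N//; exact: E.
- have [th th01 E] := @common_slope_triangles (@triangle_int R) (@side_int R) y
    (@triangle_int_sym01 R) (@triangle_int_sym12 R) (@triangle_int_slope R) triangle_int_mono.
  have muE k : pos_int (x \o lift k) = match val k with
    | 0 => triangle_int (y 1) (y 2) (y 3) | 1 => triangle_int (y 0) (y 2) (y 3)
    | 2 => triangle_int (y 0) (y 1) (y 3) | _ => triangle_int (y 0) (y 1) (y 2) end%N.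
    by rewrite pos_int2 /= !xy; case: k => [[|[|[|[|//]]]]] ki.
  exists th => // k l; rewrite !muE !xy (_ : 3`! = 6)%N//; exact: E.
Qed.

End CommonSlope.

(** * Integrals of two affine pieces separated by a hyperplane *)

Section Cutoff.
Variable R : realType.

Definition in_open_std_simplex m (v : 'rV[R]_m) : bool :=
  [forall i, 0 < v 0 i] && (\sum_i v 0 i < 1).

(** On a face, with [delta] the height above the cutting plane: the
    characteristic function of the part of the open face adherent to the upper
    part of the element.  The flag [up] tells whether that upper part is
    nonempty. *)
Definition cutoff m (up : bool) (delta : 'I_m.+1 -> R) (v : 'rV[R]_m) : R :=
  [&& up, in_open_std_simplex v & 0 <= bary delta v]%:R.

Lemma coord_measurable_bool m (b : 'rV[R]_m -> bool) :
  (forall dX (X : measurableType dX) (v : X -> 'rV[R]_m),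
    (forall i, measurable_fun [set: X] (fun x => v x 0 i)) ->
    measurable_fun [set: X] (fun x => b (v x))) ->
  coord_measurable (fun v => (b v)%:R : R).
Proof.
move=> mb dX X v mv.
rewrite (_ : (fun x => _) = fun x => if b (v x) then 1 else 0); last first.
  by apply/funext => x; case: (b _).
by apply: measurable_fun_ifT => //; exact: mb.
Qed.

(** The cutoff is a product of indicators of half-spaces. *)
Lemma coord_measurable_cutoff m up (delta : 'I_m.+1 -> R) : coord_measurable (cutoff up delta).
Proof.
move=> dX X v mv.
rewrite (_ : (fun x => _) = fun x => up%:R *
   ((\prod_i (0 < v x 0 i)%R%:R) *
    ((\sum_i v x 0 i < 1)%R%:R * (0 <= bary delta (v x))%R%:R))).
  apply: measurable_funM => //; apply: measurable_funM.
    apply: measurable_prod => i _.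
    apply: (@coord_measurable_bool _ (fun v => 0 < v 0 i)) mv => dY Y w mw.
    exact: measurable_fun_ltr.
  apply: measurable_funM.
    apply: (@coord_measurable_bool _ (fun v => \sum_i v 0 i < 1)) mv => dY Y w mw.
    by apply: measurable_fun_ltr => //; apply: measurable_sum => i.
  apply: (@coord_measurable_bool _ (fun v => 0 <= bary delta v)) mv => dY Y w mw.
  by apply: measurable_fun_ler => //; exact: coord_measurable_aform.
apply/funext => x; rewrite /cutoff /in_open_std_simplex.
have -> : \prod_i (0 < v x 0 i)%R%:R = [forall i, 0 < v x 0 i]%:R :> R.
  case: forallP => [pos_v|]; first by rewrite big1// => i _; rewrite pos_v.
  by move/forallP/forallPn => [i /negbTE vi]; rewrite (bigD1 i)//= vi mul0r.
by rewrite -!natrM !mulnb -!andbA.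
Qed.

Lemma cutoff_norm_le m up (delta : 'I_m.+1 -> R) v : `|cutoff up delta v| <= 1.
Proof. by rewrite /cutoff ger0_norm ?ler0n// lern1 leq_b1. Qed.

Lemma cutoff_integrable m up (delta p : 'I_m.+1 -> R) :
  std_simplex_integrable 1 (fun v => cutoff up delta v * bary p v).
Proof.
have [] // := @bounded_std_simplex_integrable R m 1
  (`|p ord0| + \sum_i `|p (lift ord0 i) - p ord0|)
  (fun v => cutoff up delta v * bary p v).
- by rewrite ler01 lexx.
- by apply: coord_measurableM; [exact: coord_measurable_cutoff|exact: coord_measurable_aform].
- move=> v v1; rewrite normrM; apply: le_trans (ler_piMl _ (cutoff_norm_le _ _ _)) _ => //.
  exact: aform_norm_le v1.
Qed.

Lemma bary_lin m (a : R) (p q : 'I_m.+1 -> R) v :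
  bary (fun i => a * p i + q i) v = a * bary p v + bary q v.
Proof.
rewrite !baryE; under [X in _ + X = _]eq_bigr do rewrite mulrDl -mulrA.
by rewrite big_split /= -mulr_sumr; ring.
Qed.

(** The two affine pieces [bary q] + c delta above the plane and [bary q] below
    it agree on the plane, so together they integrate as the continuous function
    [bary q] + c max(delta, 0).  The points on the plane, which may be counted
    twice, form a null set unless the whole face lies in the plane; in that case
    the last hypothesis says that exactly one of the two pieces is counted. *)
Lemma cutoff_int_sum m (up um : bool) (delta q : 'I_m.+1 -> R) (c : R) :
  (forall i, 0 < delta i -> up) -> (forall i, delta i < 0 -> um) ->
  ((forall i, delta i = 0) -> up (+) um) ->
  std_simplex_int 1 (fun v => cutoff up delta v * bary (fun i => c * delta i + q i) v) +
  std_simplex_int 1 (fun v => cutoff um (fun i => - delta i) v * bary q v) =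
  (\sum_i q i) / m.+1`!%:R + c * pos_int delta.
Proof.
move=> hup hum h0; rewrite -bary_int.
have r01 : 0 <= (1 : R) <= 1 by rewrite ler01 lexx.
set f := fun v => cutoff up _ v * _; set g := fun v => cutoff um _ v * _.
have f_int : std_simplex_integrable 1 f by exact: cutoff_integrable.
have g_int : std_simplex_integrable 1 g by exact: cutoff_integrable.
have q_int : std_simplex_integrable 1 (bary q) by exact: aform_integrable.
have p_int : std_simplex_integrable 1 (fun v => pos_part (bary delta v)).
  exact: pos_part_aform_integrable.
have [fg_int fgE] := std_simplex_int_lin 1 f_int g_int.
have [pq_int pqE] := std_simplex_int_lin c p_int q_int.
have [h_int hE] := std_simplex_int_lin (-1) pq_int fg_int.
suff : std_simplex_int 1 (fun v =>
    -1 * (c * pos_part (bary delta v) + bary q v) + (1 * f v + g v)) = 0.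
  by rewrite hE pqE fgE /pos_int; lra.
(* The exceptional hyperplanes: the facets of the simplex, indexed by Some, and
   the cutting plane, indexed by None.  If the face lies in the cutting plane,
   the latter is replaced by the empty set, with equation 1 = 0. *)
pose isz := [forall i, delta i == 0].
pose e (j : option (option 'I_m)) : R := match j with
  | None => if isz then 1 else delta ord0 | Some None => 1 | Some (Some i) => 0 end.
pose b (j : option (option 'I_m)) (i : 'I_m) : R := match j with
  | None => if isz then 0 else delta (lift ord0 i) - delta ord0
  | Some None => -1 | Some (Some k) => (i == k)%:R end.
apply: (@std_simplex_int_null _ _ _ _ _ e b) => //.
  case=> [[k|]|] /=.
  - by right; exists k; rewrite eqxx oner_neq0.
  - by left; rewrite oner_neq0.
  - rewrite /isz; case: ifPn => [_|/forallPn[i di]]; first by left; rewrite oner_neq0.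
    have [d0|] := eqVneq (delta ord0) 0; last by left.
    right; move: di; case: (unliftP ord0 i) => [k|] ->; last by rewrite d0 eqxx.
    by move=> dk; exists k; rewrite d0 subr0.
move=> v [v0 v1]; apply: contra_neqP => /forallNP nz.
have vpos i : 0 < v 0 i.
  rewrite lt_neqAle v0 andbT eq_sym; apply/eqP => vi; apply: (nz (Some (Some i))).
  rewrite /aform /= add0r (bigD1 i)//= eqxx mul1r vi add0r big1// => j /negbTE ->.
  by rewrite mul0r.
have vlt : \sum_i v 0 i < 1.
  rewrite lt_neqAle v1 andbT; apply/eqP => vi; apply: (nz (Some None)).
  by rewrite /aform /= -mulr_sumr vi mulN1r subrr.
have vin : in_open_std_simplex v by rewrite /in_open_std_simplex vlt andbT; apply/forallP.
have bN : bary (fun i => - delta i) v = - bary delta v.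
  by rewrite !baryE; under [X in _ + X = _]eq_bigr do rewrite mulNr; rewrite sumrN; ring.
rewrite /f /g /cutoff vin bN oppr_ge0 bary_lin /=.
have [isz0|isz0] := boolP isz.
  have d0 i : delta i = 0 by apply/eqP; exact: (forallP isz0).
  have -> : bary delta v = 0.
    by rewrite baryE d0 mul0r add0r big1// => i _; rewrite d0 mul0r.
  have := h0 d0; rewrite /pos_part maxxx lexx !andbT; case: (up); case: (um) => //= _; lra.
have bn0 : bary delta v != 0.
  apply/eqP => b0; apply: (nz None); rewrite /e /b (negbTE isz0).
  exact: b0.
have [bpos|bneg] := ltP 0 (bary delta v).
  have -> : up.
    apply: contraLR bpos => nup; rewrite -leNgt baryE.
    have dle i : delta i <= 0 by rewrite leNgt; apply: contra nup; exact: hup.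
    rewrite -oppr_ge0 opprD; apply: addr_ge0.
      by rewrite -mulNr; apply: mulr_ge0; rewrite ?oppr_ge0// subr_ge0.
    rewrite -sumrN; apply: sumr_ge0 => i _; rewrite -mulNr.
    by apply: mulr_ge0; rewrite ?oppr_ge0.
  rewrite (ltW bpos) andbF /pos_part max_l ?ltW//=; lra.
have {}bneg : bary delta v < 0 by rewrite lt_neqAle bn0.
have -> : um.
  apply: contraLR bneg => num; rewrite -leNgt baryE.
  have dge i : 0 <= delta i by rewrite leNgt; apply: contra num; exact: hum.
  apply: addr_ge0; first by apply: mulr_ge0; rewrite ?subr_ge0.
  by apply: sumr_ge0 => i _; apply: mulr_ge0.
rewrite (leNgt 0) bneg andbF andbT /pos_part max_r ?ltW//=; lra.
Qed.

End Cutoff.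

(** * Affine functions and simplices *)

Section AffineFunctions.
Variables (R : realType) (d : nat).
Local Notation V := 'rV[R]_d.+1.

Lemma dotC (u v : V) : dot u v = dot v u.
Proof. by apply: eq_bigr => i _; rewrite mulrC. Qed.
Lemma dotDl (u v w : V) : dot (u + v) w = dot u w + dot v w.
Proof. by rewrite /dot -big_split; apply: eq_bigr => i _; rewrite !mxE mulrDl. Qed.
Lemma dotZl a (u w : V) : dot (a *: u) w = a * dot u w.
Proof. by rewrite /dot mulr_sumr; apply: eq_bigr => i _; rewrite !mxE mulrA. Qed.
Lemma dotNl (u w : V) : dot (- u) w = - dot u w.
Proof. by rewrite -scaleN1r dotZl mulN1r. Qed.
Lemma dotDr (u v w : V) : dot w (u + v) = dot w u + dot w v.
Proof. by rewrite dotC dotDl !(dotC w). Qed.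
Lemma dotZr a (u w : V) : dot w (a *: u) = a * dot w u.
Proof. by rewrite dotC dotZl (dotC w). Qed.
Lemma dotNr (u w : V) : dot w (- u) = - dot w u.
Proof. by rewrite dotC dotNl (dotC w). Qed.
Lemma dot0l (w : V) : dot 0 w = 0.
Proof. by rewrite -(scale0r 0) dotZl mul0r. Qed.
Lemma dot_suml (I : finType) (F : I -> V) w : dot (\sum_i F i) w = \sum_i dot (F i) w.
Proof. exact: (big_morph (fun u => dot u w) (fun u v => dotDl u v w) (dot0l w)). Qed.
Lemma dot_ge0 (u : V) : 0 <= dot u u.
Proof. by apply: sumr_ge0 => i _; rewrite -expr2 sqr_ge0. Qed.
Lemma dot_eq0 (u : V) : (dot u u == 0) = (u == 0).
Proof.
apply/idP/eqP => [|->]; last by rewrite dot0l.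
rewrite psumr_eq0 => [/allP u0|i _]; last by rewrite -expr2 sqr_ge0.
apply/rowP => i; rewrite mxE; apply/eqP.
by have := u0 i (mem_index_enum i); rewrite mulf_eq0 orbb.
Qed.
Lemma P1_barycentric (f : V -> R) m (c : 'I_m -> V) (l : 'I_m -> R) : is_P1 f ->
  \sum_i l i = 1 -> f (\sum_i l i *: c i) = \sum_i l i * f (c i).
Proof.
move=> [a [g fE]] l1; rewrite fE dotC dot_suml -[a]mul1r -l1 mulr_suml -big_split.
by apply: eq_bigr => i _; rewrite fE mulrDr dotZl [dot g _]dotC.
Qed.

Lemma affine_paramE m (c : 'I_m.+1 -> V) (s : 'rV[R]_m) :
  c ord0 + s *m edge_mx c =
  (1 - \sum_i s 0 i) *: c ord0 + \sum_i s 0 i *: c (lift ord0 i).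
Proof.
rewrite mulmx_sum_row; under eq_bigr do rewrite rowK scalerBr.
by rewrite sumrB -scaler_suml scalerBl scale1r addrAC addrA.
Qed.

(** The barycentric coordinates of the point of parameter [s]. *)
Definition bcoord m (s : 'rV[R]_m) (i : 'I_m.+1) : R :=
  if unlift ord0 i is Some j then s 0 j else 1 - \sum_j s 0 j.

Lemma bcoord0 m (s : 'rV[R]_m) : bcoord s ord0 = 1 - \sum_j s 0 j.
Proof. by rewrite /bcoord unlift_none. Qed.

Lemma bcoordS m (s : 'rV[R]_m) i : bcoord s (lift ord0 i) = s 0 i.
Proof. by rewrite /bcoord liftK. Qed.

Lemma bcoord_sum m (s : 'rV[R]_m) : \sum_i bcoord s i = 1.
Proof. by rewrite big_ord_recl bcoord0 (eq_bigr _ (fun i _ => bcoordS s i)) subrK. Qed.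

Lemma bcoordE m (c : 'I_m.+1 -> V) (s : 'rV[R]_m) :
  c ord0 + s *m edge_mx c = \sum_i bcoord s i *: c i.
Proof.
rewrite affine_paramE big_ord_recl bcoord0; congr (_ + _).
by apply: eq_bigr => i _; rewrite bcoordS.
Qed.

Lemma P1_param (f : V -> R) m (c : 'I_m.+1 -> V) (s : 'rV[R]_m) : is_P1 f ->
  f (c ord0 + s *m edge_mx c) = bary (f \o c) s.
Proof.
move=> fP; rewrite bcoordE P1_barycentric ?bcoord_sum// big_ord_recl bcoord0 baryE mulrC.
by congr (_ + _); apply: eq_bigr => i _; rewrite bcoordS mulrC.
Qed.

Lemma P1_continuous (f : V -> R) : is_P1 f -> continuous f.
Proof.
move=> [a [g fE]]; rewrite (_ : f = fun x => a + dot g x); last exact/funext.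
move=> x; apply: (@cvgD R R^o V (nbhs x) _ (cst a) (dot g)); first exact: cvg_cst.
apply: cvg_big => [|i _]; first exact: add_continuous.
apply: cvgM; first exact: cvg_cst.
exact: coord_continuous.
Qed.

Lemma P1_grad (f : V -> R) a (g : V) x : (forall x, f x = a + dot g x) -> grad f x = g.
Proof.
move=> fE; apply/rowP => i; rewrite mxE; apply: cvg_lim => //.
rewrite (_ : g 0 i = dot g (delta_mx 0 i)); last first.
  rewrite /dot (bigD1 i)//= big1 ?addr0 => [|j ji]; rewrite mxE eqxx ?eqxx ?mulr1//.
  by rewrite (negbTE ji) mulr0.
apply: cvg_near_cst; near=> h.
have h0 : h != 0 by near: h; exact: nbhs_dnbhs_neq.
rewrite /= !fE dotDr dotZr opprD addrACA subrr add0r addrK.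
by rewrite -[LHS]/(h^-1 * _) mulrA mulVf// mul1r.
Unshelve. all: by end_near.
Qed.

Definition aff_indep m (c : 'I_m -> V) := forall a : 'I_m -> R,
  \sum_i a i = 0 -> \sum_i a i *: c i = 0 -> forall i, a i = 0.

Lemma unitmx_aff_indep (T : 'I_d.+2 -> V) : edge_mx T \in unitmx -> aff_indep T.
Proof.
move=> uT a a0 aT.
pose s : V := \row_i a (lift ord0 i).
have aE : a ord0 = - \sum_i s 0 i.
  have := a0; rewrite big_ord_recl => /eqP; rewrite addr_eq0 => /eqP ->.
  by congr (- _); apply: eq_bigr => i _; rewrite mxE.
have s0 : s = 0.
  rewrite -[s](mulmxK uT) (_ : s *m _ = 0) ?mul0mx//.
  apply: (addrI (T ord0)); rewrite addr0 affine_paramE scalerBl scale1r -addrA.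
  rewrite -scaleNr -aE -[RHS]addr0; congr (_ + _).
  rewrite -[RHS]aT [RHS]big_ord_recl; congr (_ + _).
  by apply: eq_bigr => i _; rewrite mxE.
move=> i; case: (unliftP ord0 i) => [j|] ->; last first.
  by rewrite aE big1 ?oppr0// => j _; rewrite s0 mxE.
by have /rowP/(_ j) := s0; rewrite !mxE.
Qed.

Lemma aff_indep_face m (c : 'I_m.+2 -> V) k : aff_indep c -> aff_indep (face c k).
Proof.
move=> ic a a0 ac j.
pose b i := if unlift k i is Some j then a j else 0.
have bk : b k = 0 by rewrite /b unlift_none.
have bl i : b (lift k i) = a i by rewrite /b liftK.
rewrite -bl; apply: ic; rewrite (bigD1_ord k)//= bk ?scale0r add0r.
  by under eq_bigr do rewrite bl.
by under eq_bigr do rewrite bl.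
Qed.

Lemma aff_indep_param0 m (c : 'I_m.+1 -> V) (s : 'rV[R]_m) : aff_indep c ->
  s *m edge_mx c = 0 -> s = 0.
Proof.
move=> ic sE; pose a i := bcoord s i - bcoord 0 i.
have a0 : forall i, a i = 0.
  apply: ic; first by rewrite sumrB !bcoord_sum subrr.
  under eq_bigr do rewrite scalerBl.
  by rewrite sumrB -!bcoordE sE mul0mx subrr.
by apply/rowP => i; have /eqP := a0 (lift ord0 i); rewrite subr_eq0 !bcoordS => /eqP.
Qed.

Lemma osimplex_param m (c : 'I_m.+1 -> V) (s : 'rV[R]_m) : aff_indep c ->
  osimplex c (c ord0 + s *m edge_mx c) <-> in_open_std_simplex s.
Proof.
move=> ic; split.
  move=> [l [lpos l1]]; rewrite bcoordE => E.
  have az : forall i, bcoord s i - l i = 0.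
    apply: ic; first by rewrite sumrB bcoord_sum l1 subrr.
    under eq_bigr do rewrite scalerBl.
    by rewrite sumrB E subrr.
  have sl i : bcoord s i = l i by apply/eqP; rewrite -subr_eq0 az.
  apply/andP; split; first by apply/forallP => i; rewrite -bcoordS sl.
  by rewrite -subr_gt0 -bcoord0 sl.
move=> /andP[/forallP spos slt]; exists (bcoord s); split.
- by move=> i; case: (unliftP ord0 i) => [j|] ->; rewrite ?bcoordS// bcoord0 subr_gt0.
- exact: bcoord_sum.
- exact: bcoordE.
Qed.

End AffineFunctions.

Section OpenHalf.
Variables (R : realType) (d : nat).
Local Notation V := 'rV[R]_d.+1.

Lemma osimplex_segment m (T : 'I_m.+1 -> V) x y (e : R) :
  csimplex T x -> osimplex T y -> 0 < e <= 1 -> osimplex T (x + e *: (y - x)).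
Proof.
move=> [l [l0 l1 ->]] [k [k0 k1 ->]] /andP[e0 e1].
exists (fun i => (1 - e) * l i + e * k i); split.
- by move=> i; have := l0 i; have := k0 i; nra.
- by rewrite big_split /= -!mulr_sumr l1 k1; ring.
- under [RHS]eq_bigr do rewrite scalerDl -!scalerA.
  rewrite big_split /= -!scaler_sumr scalerBr addrA scalerBl scale1r addrAC.
  by [].
Qed.

Lemma barycenter_osimplex m (T : 'I_m.+1 -> V) :
  osimplex T (\sum_i m.+1%:R^-1 *: T i).
Proof.
exists (fun _ => m.+1%:R^-1); split; [by move=> i; rewrite invr_gt0 ltr0n| |by []].
by rewrite sumr_const card_ord -(mulr_natl m.+1%:R^-1) divff// pnatr_eq0.
Qed.

Lemma vertex_csimplex m (T : 'I_m.+1 -> V) i : csimplex T (T i).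
Proof.
exists (fun j => (j == i)%:R); split => [j||]; first by rewrite ler0n.
  by rewrite (bigD1 i)//= eqxx big1 ?addr0// => j /negbTE ->.
rewrite (bigD1 i)//= eqxx scale1r big1 ?addr0// => j /negbTE ->.
by rewrite scale0r.
Qed.

Lemma P1_segment (f : V -> R) x y (e : R) : is_P1 f ->
  f (x + e *: (y - x)) = f x + e * (f y - f x).
Proof. by move=> [a [g fE]]; rewrite !fE dotDr dotZr dotDr dotNr; ring. Qed.

(** On the closed simplex an affine function is positive somewhere iff it is
    positive at a vertex, and positivity at a vertex persists a little inside. *)
Lemma half_nonempty m (T : 'I_m.+1 -> V) (f : V -> R) : is_P1 f ->
  (osimplex T `&` [set x | 0 < f x]) !=set0 <-> exists i, 0 < f (T i).
Proof.
move=> fP; split.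
  move=> [_ [[l [l0 l1 ->]] /=]]; rewrite P1_barycentric// => fpos.
  have [/existsP[i fi]|/existsPn nf] := boolP [exists i, 0 < f (T i)]; first by exists i.
  move: fpos; rewrite ltNge => /negP[]; rewrite -oppr_ge0 -sumrN.
  apply: sumr_ge0 => i _; rewrite -mulrN mulr_ge0 ?(ltW (l0 i))//.
  by rewrite oppr_ge0 leNgt nf.
move=> [i fi]; set x := T i in fi; set b := \sum_i m.+1%:R^-1 *: T i.
pose s := f x + `|f b|.
have s0 : 0 < s by rewrite /s; have := normr_ge0 (f b); lra.
(* With this step the move towards the barycenter loses at most half of f x. *)
pose e := f x / (2 * s).
have e2 : e * (2 * s) = f x by rewrite /e mulfVK// mulf_neq0 ?gt_eqF.
have e0 : 0 < e by rewrite /e divr_gt0// mulr_gt0.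
have e1 : e <= 1.
  rewrite /e ler_pdivrMr ?mulr_gt0// mul1r /s; have := normr_ge0 (f b); lra.
exists (x + e *: (b - x)); split.
  apply: osimplex_segment; [exact: vertex_csimplex|exact: barycenter_osimplex|].
  by rewrite e0.
rewrite /= P1_segment//; have := ler_norm (- f b); rewrite normrN => fb.
by have : e * (f x - f b) <= e * s; [rewrite ler_pM2l// /s|]; lra.
Qed.

(** A boundary point of the simplex with 0 <= f x is a limit of points of the
    upper part as soon as that part is nonempty: move towards any of its
    points. *)
Lemma boundary_half m (T : 'I_m.+1 -> V) (f : V -> R) x : is_P1 f ->
  csimplex T x -> ~ osimplex T x ->
  boundary (osimplex T `&` [set x | 0 < f x]) x <->
  (exists i, 0 < f (T i)) /\ 0 <= f x.
Proof.
move=> fP xT xnT; have cf := P1_continuous fP; split.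
  move=> [clx _]; split.
    apply/half_nonempty => //.
    by have [|y [yT _]] := clx setT; [exact: filterT|exists y].
  rewrite leNgt; apply/negP => fx.
  have [y [[_ /= fy] /= fy']] := clx _ (cvgr_lt (f := f) _ (cf x) _ fx).
  by move: fy'; rewrite ltNge (ltW fy).
move=> [/half_nonempty -/(_ fP)[y [yT /= fy]] fx]; split.
  move=> B Bx.
  have ray : x + e *: (y - x) @[e --> (0 : R)] --> x.
    suff : x + e *: (y - x) @[e --> (0 : R)] --> x + (0 : R) *: (y - x).
      by rewrite scale0r addr0.
    apply: cvgD; first exact: cvg_cst.
    exact: scalel_continuous.
  have BN : \forall e \near (0 : R)^'+, B (x + e *: (y - x)).
    exact: (cvg_at_right_filter ray) Bx.
  have [e [[e0 e1] Be]] := filter_ex (filterI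
    (filterI (nbhs_right_gt 0) (nbhs_right_le (@ltr01 R))) BN).
  exists (x + e *: (y - x)); split => //; split.
    by apply: osimplex_segment => //; rewrite e0.
  by rewrite /= P1_segment//; nra.
by move=> /interior_subset[].
Qed.

End OpenHalf.

(** * Face means on a simplex cut by a plane *)

Section Gram.
Variable R : realType.

Lemma mulmx_tr_gt0 n (u : 'rV[R]_n) : u != 0 -> 0 < (u *m u^T) 0 0.
Proof.
move=> u0; rewrite mxE; under eq_bigr do rewrite mxE -expr2.
rewrite lt_neqAle eq_sym sumr_ge0 ?andbT => [|i _]; last exact: sqr_ge0.
apply: contra u0; rewrite psumr_eq0 => [/allP h|i _]; last exact: sqr_ge0.
apply/eqP/rowP => i; rewrite mxE; apply/eqP.
by have := h i (mem_index_enum i); rewrite sqrf_eq0.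
Qed.

(** The matrices (1 - t) G + t I, for t in [0, 1], join the Gram matrix G to the
    identity within positive definite, hence invertible, matrices.  Their
    determinant is a polynomial in t without zero on [0, 1], so it keeps the
    sign that it has at t = 1. *)
Lemma gram_det_gt0 m n (E : 'M[R]_(m, n)) :
  (forall s : 'rV_m, s *m E = 0 -> s = 0) -> 0 < \det (E *m E^T).
Proof.
move=> E_inj; set G := E *m E^T.
pose P : 'M[{poly R}]_m := \matrix_(i, j) (G i j *: (1 - 'X) + (i == j)%:R *: 'X).
have PE t : map_mx (horner_eval t) P = (1 - t) *: G + t%:M.
  apply/matrixP => i j; rewrite !mxE /horner_eval !hornerE mulrC.
  by case: eqP => _; rewrite ?mul1r ?mul0r ?mulr1n ?mulr0n.
have detE t : (\det P).[t] = \det ((1 - t) *: G + t%:M).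
  by rewrite -PE det_map_mx.
have nz t : 0 <= t <= 1 -> (\det P).[t] != 0.
  move=> /andP[t0 t1]; rewrite detE; apply/det0P => -[v v0].
  move/(congr1 (fun w => (w *m v^T) 0 0)); rewrite mul0mx [RHS]mxE.
  rewrite mulmxDr mulmxDl -scalemxAr -scalemxAl mul_mx_scalar -scalemxAl.
  have vE0 : v *m E != 0 by apply: contra v0 => /eqP/E_inj ->.
  have := mulmx_tr_gt0 v0; have := mulmx_tr_gt0 vE0.
  rewrite trmx_mul mulmxA -[v *m E *m E^T]mulmxA -/G.
  rewrite [in X in _ -> _ -> X]mxE [X in X + _]mxE [X in _ + X]mxE.
  by move: ((v *m G *m v^T) 0 0) ((v *m v^T) 0 0) => a b; nra.
have d1 : (\det P).[1] = 1 by rewrite detE subrr scale0r add0r det1.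
have d0 : (\det P).[0] = \det G by rewrite detE subr0 scale1r raddf0 addr0.
rewrite ltNge; apply/negP => G0.
have [|t t01] := poly_ivt (p := \det P) (a := 0) (b := 1) ler01.
  by rewrite d0 d1 G0 ler01.
by rewrite rootE (negbTE (nz _ _)).
Qed.

End Gram.

Section Faces.
Variables (R : realType) (d : nat).
Local Notation V := 'rV[R]_d.+1.

Lemma face_csimplex m (T : 'I_m.+2 -> V) k x : osimplex (face T k) x -> csimplex T x.
Proof.
move=> [l [l0 l1 ->]].
exists (fun i => if unlift k i is Some j then l j else 0); split.
- by move=> i; case: unliftP => [j|] _ //; exact: ltW.
- rewrite (bigD1_ord k)//= unlift_none add0r -l1.
  by apply: eq_bigr => i _; rewrite liftK.
- rewrite [RHS](bigD1_ord k)//= unlift_none scale0r add0r.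
  by apply: eq_bigr => i _; rewrite liftK.
Qed.

Lemma face_not_osimplex m (T : 'I_m.+2 -> V) k x : aff_indep T ->
  osimplex (face T k) x -> ~ osimplex T x.
Proof.
move=> iT [l [l0 l1 ->]] [n [n0 n1 E]].
pose a i := (if unlift k i is Some j then l j else 0) - n i.
have := n0 k; suff : a k = 0 by rewrite /a unlift_none; lra.
apply: iT; rewrite /a.
  rewrite sumrB n1 (bigD1_ord k)//= unlift_none add0r.
  by under eq_bigr do rewrite liftK; rewrite l1 subrr.
under eq_bigr do rewrite scalerBl.
rewrite sumrB -E (bigD1_ord k)//= unlift_none scale0r add0r.
by under eq_bigr do rewrite liftK; rewrite subrr.
Qed.

Lemma indic_face_boundary m (T : 'I_m.+2 -> V) (f : V -> R) k (s : 'rV[R]_m) :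
  is_P1 f -> aff_indep T ->
  \1_(osimplex (face T k) `&` boundary (osimplex T `&` [set x | 0 < f x]))
    (face T k ord0 + s *m edge_mx (face T k)) =
  cutoff [exists i, 0 < f (T i)] (f \o face T k) s :> R.
Proof.
move=> fP iT; have iF := aff_indep_face (k := k) iT.
rewrite indicE /cutoff; congr ((nat_of_bool _)%:R); apply/idP/idP.
  rewrite inE => -[Fx /boundary_half].
  move=> /(_ fP (face_csimplex Fx) (face_not_osimplex iT Fx))[fi f0].
  apply/and3P; split; first by apply/existsP.
    by move/osimplex_param : Fx; apply.
  by rewrite -P1_param.
move=> /and3P[/existsP fi /osimplex_param -/(_ _ _ iF) Fx]; rewrite -P1_param// => f0.
rewrite inE; split=> //.
by apply/boundary_half => //; [exact: face_csimplex Fx|exact: face_not_osimplex Fx].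
Qed.

End Faces.

Section Element.
Variables (R : realType) (d : nat).
Local Notation V := 'rV[R]_d.+1.

Definition height (x0 n x : V) : R := dot (x - x0) n.

Lemma height_P1 (x0 n : V) : is_P1 (height x0 n).
Proof.
by exists (- dot x0 n), n => x; rewrite /height dotDl dotNl (dotC n) addrC.
Qed.

Lemma oppr_P1 (f : V -> R) : is_P1 f -> is_P1 (fun x => - f x).
Proof. by move=> [a [g fE]]; exists (- a), (- g) => x; rewrite fE dotNl opprD. Qed.

(** In the mean over a face the Gram factor of the parametrization cancels
    against the area; what remains is the normalization [d`!] of the standard
    simplex. *)
Lemma M_cutoffE (T : 'I_d.+2 -> V) (x0 n : V) k (phi : (V -> R) * (V -> R)) :
  aff_indep T -> is_P1 phi.1 -> is_P1 phi.2 ->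
  let delta i := height x0 n (T i) in
  M T x0 n k phi = d`!%:R *
    (std_simplex_int 1 (fun s => cutoff [exists i, 0 < delta i] (delta \o lift k) s *
        bary (phi.1 \o T \o lift k) s) +
     std_simplex_int 1 (fun s =>
        cutoff [exists i, delta i < 0] (fun i => - delta (lift k i)) s *
        bary (phi.2 \o T \o lift k) s)).
Proof.
move=> iT p1 p2 delta; have iF := aff_indep_face (k := k) iT.
have hP := height_P1 x0 n.
have EThp : Thp T x0 n = osimplex T `&` [set x | 0 < height x0 n x] by [].
have EThm : Thm T x0 n = osimplex T `&` [set x | 0 < - height x0 n x].
  by congr (_ `&` _); apply/funext => x /=; rewrite oppr_gt0.
have Eex : [exists i, delta i < 0] = [exists i, 0 < - height x0 n (T i)].
  by apply: eq_existsb => i; rewrite oppr_gt0.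
have G0 : 0 < \det (edge_mx (face T k) *m (edge_mx (face T k))^T).
  by apply: gram_det_gt0 => s; exact: aff_indep_param0 iF.
rewrite /M /surface_area /surface_int -mulrDr EThp EThm Eex.
set G := Num.sqrt _; have Gn0 : G != 0 by rewrite gt_eqF// sqrtr_gt0.
have I1 : std_simplex_int 1 (fun _ : 'rV[R]_d => 1) = (d`!%:R)^-1.
  have := @bary_int R d (fun _ => 1); rewrite sumr_const card_ord -mulr_natl mulr1.
  rewrite factS natrM invfM mulrA divff ?pnatr_eq0// mul1r => <-.
  congr std_simplex_int; apply/funext => v.
  by rewrite baryE; under [X in _ + X]eq_bigr do rewrite mul1r; rewrite mul1r subrK.
rewrite I1 invfM invrK mulrAC mulrA mulVf// mul1r mulrC; congr (_ * (_ + _)).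
- congr std_simplex_int; apply/funext => s.
  by rewrite (indic_face_boundary k s hP iT) (P1_param _ _ p1).
- congr std_simplex_int; apply/funext => s.
  by rewrite (indic_face_boundary k s (oppr_P1 hP) iT) (P1_param _ _ p2).
Qed.

(** * The tangent frame, the diameter and the coefficients *)

(** The normal and the tangent frame are the rows of an orthogonal matrix. *)
Lemma tangent_decomposition (n : V) (t : 'I_d -> V) (v : V) :
  dot n n = 1 -> tangent_frame n t -> (forall i, dot v (t i) = 0) ->
  v = dot v n *: n.
Proof.
move=> nn [tt tn] vt.
pose Q : 'M[R]_d.+1 := \matrix_i (if unlift ord0 i is Some j then t j else n).
have Q0 : row ord0 Q = n by rewrite rowK unlift_none.
have QS j : row (lift ord0 j) Q = t j by rewrite rowK liftK.
have QQ : Q *m Q^T = 1%:M.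
  apply/matrixP => i j; rewrite [RHS]mxE.
  have -> : (Q *m Q^T) i j = dot (row i Q) (row j Q).
    by rewrite !mxE; apply: eq_bigr => k _; rewrite !mxE.
  case: (unliftP ord0 i) => [i'|] ->; case: (unliftP ord0 j) => [j'|] ->;
    rewrite ?Q0 ?QS ?tt ?tn ?nn ?(inj_eq (@lift_inj _ _)) ?eqxx//.
  by rewrite dotC tn.
have {}QQ := mulmx1C QQ.
rewrite -[LHS]mulmx1 -QQ mulmxA mulmx_sum_row big_ord_recl Q0.
have vQ i : (v *m Q^T) 0 i = dot v (row i Q).
  by rewrite mxE; apply: eq_bigr => k _; rewrite !mxE.
rewrite vQ Q0 big1 ?addr0// => i _.
by rewrite vQ QS vt scale0r.
Qed.

Lemma ediam_simplex_gt0 (T : 'I_d.+2 -> V) : aff_indep T -> 0 < mesh_diam T.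
Proof.
move=> iT; rewrite /mesh_diam /ediam; set S := [set r | _].
have pt (a : R) : 0 < a -> a * d.+1%:R < 1 ->
    osimplex T (T ord0 + (const_mx a : 'rV[R]_d.+1) *m edge_mx T).
  move=> a0 a1; apply/osimplex_param => //; apply/andP; split.
    by apply/forallP => i; rewrite mxE.
  by under eq_bigr do rewrite mxE; rewrite sumr_const card_ord -mulr_natr.
have d0 k : 0 < k.+1%:R :> R by rewrite ltr0n.
(* Two distinct interior points: equal parameters 1/(d+2), or 1/(d+3), in each
   of the d+1 coordinates have a sum less than 1. *)
have := pt (d.+2%:R^-1); have := pt (d.+3%:R^-1).
rewrite !invr_gt0 !d0 ![_^-1 * _]mulrC !ltr_pdivrMr// !mul1r !ltr_nat !ltnS leqnSn leqnn.
move=> /(_ erefl erefl) yT /(_ erefl erefl) xT.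
set x := (X in osimplex T X) in xT; set y := (X in osimplex T X) in yT.
have xy : x - y != 0.
  rewrite subr_eq0; apply/eqP => /addrI /eqP; rewrite -subr_eq0 -mulmxBl => /eqP.
  move=> /(aff_indep_param0 iT)/rowP/(_ ord0); rewrite !mxE => /eqP.
  rewrite subr_eq0 => /eqP/invr_inj/eqP.
  by rewrite eqr_nat eqSS eqn_leq ltnn andbF.
have ub : has_ubound S.
  exists (Num.sqrt (\sum_j (\sum_i `|T i 0 j|) ^+ 2)) => r [u [v [uT vT ->]]].
  rewrite /enorm; apply: ler_wsqrtr; apply: ler_sum => j _; rewrite -expr2.
  move: uT vT => [l [l0 l1 ->]] [k [k0 k1 ->]].
  have le1 (w : 'I_d.+2 -> R) i : (forall i, 0 < w i) -> \sum_i w i = 1 -> w i <= 1.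
    move=> w0 <-; rewrite (bigD1 i)//= lerDl; apply: sumr_ge0 => h _; exact: ltW.
  rewrite -real_normK ?num_real//; apply: lerXn2r; rewrite ?nnegrE ?normr_ge0//.
    by apply: sumr_ge0 => i _; exact: normr_ge0.
  rewrite -sumrB summxE; apply: le_trans (ler_norm_sum _ _ _) _.
  apply: ler_sum => i _; rewrite -scalerBl mxE normrM ler_piMl//.
  rewrite ler_norml; have := le1 l i l0 l1; have := le1 k i k0 k1.
  by have := l0 i; have := k0 i; move=> *; apply/andP; split; lra.
have Sxy : S (enorm (x - y)) by exists x, y.
apply: lt_le_trans (ub_le_sup ub Sxy).
by rewrite /enorm sqrtr_gt0 lt_neqAle eq_sym dot_eq0 xy dot_ge0.
Qed.

End Element.

Section Ellipticity.
Variables (R : realType) (d : nat).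
Local Notation V := 'rV[R]_d.+1.

Lemma quad_formE (A : 'M[R]_d.+1) (v : V) :
  quad_form A v = \sum_i \sum_j v 0 i * (v 0 j * A i j).
Proof.
apply: eq_bigr => i _; rewrite mxE mulr_sumr.
by apply: eq_bigr => j _; rewrite mxE.
Qed.

Lemma quad_form_closure (A : set V) (B : V -> 'M[R]_d.+1) (b : R) (v x : V) :
  (forall i j, {within closure A, continuous (fun x => B x i j)}) ->
  (forall x, A x -> b <= quad_form (B x) v) -> closure A x ->
  b <= quad_form (B x) v.
Proof.
move=> cB Bb clx; rewrite leNgt; apply/negP => lt_b.
have cq : (fun y => quad_form (B y) v) @ within (closure A) (nbhs x) --> quad_form (B x) v.
  rewrite quad_formE; under eq_fun do rewrite quad_formE.
  apply: cvg_big => [|i _]; first exact: add_continuous.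
  apply: cvg_big => [|j _]; first exact: add_continuous.
  apply: cvgM; first exact: cvg_cst.
  apply: cvgM; first exact: cvg_cst.
  by have /subspace_continuousP := cB i j; apply.
have near_lt : \forall y \near x, closure A y -> quad_form (B y) v < b.
  exact: (@cvgr_lt R V (within (closure A) (nbhs x)) _ _ _ cq _ lt_b).
have [y [Ay /(_ (subset_closure Ay))]] := clx _ near_lt.
by rewrite /= ltNge Bb.
Qed.

(** Only the boundary of [Om] is given to be the interface.  That points of the
    interface adhere to [Op] too comes from the local equation g = 0: the
    gradient does not vanish, so g takes positive values arbitrarily close. *)
Lemma interface_closure_Op (Omega Gamma Op Om : set V) (n : V -> V) :
  interface Omega Gamma Op Om n -> Gamma `<=` closure Op.
Proof.
move=> hG x Gx; have [U [g [[oU Ux] [C1g _] gU]]] := interface_C2 hG Gx.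
have [gx0 _ _ dg _] := gU x Ux; have {}gx0 := gx0.1 Gx.
have [i Di] : exists i, 'D_(delta_mx 0 i) g x != 0.
  apply/not_existsP => D0; move/negP: dg; apply; apply/eqP/rowP => i; rewrite !mxE.
  by apply/eqP/negPn/negP; exact: D0.
have [dgx _] := C1g x Ux i; set D := 'D_(delta_mx 0 i) g x in Di.
have cq : h^-1 *: (g (h *: delta_mx 0 i + x) - g x) @[h --> (0 : R)^'] --> D.
  exact: dgx.
move=> B Bx.
have UBx : nbhs x (U `&` B) by apply: filterI => //; exact: open_nbhs_nbhs.
have ray : (h *: delta_mx 0 i + x : V) @[h --> (0 : R)] --> x.
  suff : (h *: delta_mx 0 i + x : V) @[h --> (0 : R)] --> (0 : R) *: delta_mx 0 i + x.
    by rewrite scale0r add0r.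
  by apply: cvgD; [exact: scalel_continuous|exact: cvg_cst].
have near_UB : \forall h \near (0 : R)^', (U `&` B) (h *: delta_mx 0 i + x).
  have ray' : (h *: delta_mx 0 i + x : V) @[h --> (0 : R)^'] --> x.
    exact: cvg_within_filter ray.
  exact: ray' _ UBx.
have near_D : \forall h \near (0 : R)^', 0 < D * (h^-1 *: (g (h *: delta_mx 0 i + x) - g x)).
  have D2 : 0 < D * D by rewrite -expr2 exprn_even_gt0.
  exact: cvgr_gt _ (cvgM (cvg_cst D) cq) _ D2.
have near_both := filterI near_UB near_D.
move: near_both => /= [e /= e0 He].
(* A step along the axis in the direction in which g increases. *)
pose h := Num.sg D * (e / 2).
have sgD : `|Num.sg D| = 1 by rewrite normr_sg Di.
have h0 : h != 0 by rewrite mulf_neq0 ?sgr_eq0// mulf_neq0 ?gt_eqF.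
have [] := He h _ h0.
  rewrite /ball_ /= sub0r normrN normrM sgD mul1r gtr0_norm ?divr_gt0//; lra.
move=> [Uh Bh]; rewrite gx0 subr0 => Dg.
exists (h *: delta_mx 0 i + x); split=> //.
have [_ [_ gop] _ _ _] := gU _ Uh; apply: gop.
have hD : 0 < h * D.
  by rewrite /h mulrAC -normrEsg mulr_gt0 ?normr_gt0// divr_gt0.
move: Dg hD h0; rewrite -[_ *: _]/(h^-1 * _).
clear Uh Bh; move: h (g _) => h gy Dg hD h0.
have : 0 < h * D * (D * (h^-1 * gy)) by exact: mulr_gt0.
have -> : h * D * (D * (h^-1 * gy)) = D ^+ 2 * gy by field.
by rewrite pmulr_rgt0 // exprn_even_gt0.
Qed.

(** Ellipticity passes to the limit from [Op] and [Om] to the interface. *)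
Lemma interface_elliptic (Omega Gamma Op Om : set V) (n : V -> V)
    (B Bp Bm : V -> 'M[R]_d.+1) (x v : V) :
  interface Omega Gamma Op Om n -> coefficient Op Om B Bp Bm ->
  Gamma x -> v != 0 ->
  0 < quad_form (Bp x) v /\ 0 < quad_form (Bm x) v.
Proof.
move=> hG hB Gx v0.
have vv : 0 < dot v v by rewrite lt_neqAle eq_sym dot_eq0 v0 dot_ge0.
split.
- have [bm [bM [bm0 _ bB]]] := coefficient_boundp hB.
  apply: (@lt_le_trans _ _ (bm * dot v v)); first exact: mulr_gt0.
  apply: (@quad_form_closure Op Bp) => [i j|y Oy|].
  + by case: (coefficient_C1p hB i j).
  + by case/andP: (bB y v Oy).
  + exact: interface_closure_Op hG _ Gx.
- have [bm [bM [bm0 _ bB]]] := coefficient_boundm hB.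
  apply: (@lt_le_trans _ _ (bm * dot v v)); first exact: mulr_gt0.
  apply: (@quad_form_closure Om Bm) => [i j|y Oy|].
  + by case: (coefficient_C1m hB i j).
  + by case/andP: (bB y v Oy).
  + by have := Gx; rewrite (interface_boundary hG) => -[].
Qed.

End Ellipticity.

(** * Unisolvence *)

Section LinearSystem.
Variables (R : realType) (d : nat).
Local Notation V := 'rV[R]_d.+1.

Lemma row_linear_surj n (L : 'rV[R]_n -> 'rV[R]_n) :
  (forall a u v, L (a *: u + v) = a *: L u + L v) ->
  (forall u, L u = 0 -> u = 0) -> forall y, exists x, L x = y.
Proof.
move=> Llin Linj y.
pose LL : {linear 'rV[R]_n -> 'rV[R]_n} :=
  HB.pack L (GRing.isLinear.Build R 'rV[R]_n 'rV[R]_n *:%R L Llin).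
have LE u : L u = u *m lin1_mx LL by rewrite mul_rV_lin1.
have unitL : lin1_mx LL \in unitmx.
  rewrite unitmxE unitfE; apply/det0P => -[u u0 uL].
  by move: u0; rewrite [u]Linj ?eqxx// LE.
by exists (y *m invmx (lin1_mx LL)); rewrite LE mulmxKV.
Qed.

Definition aff (u : 'rV[R]_d.+2) (x : V) : R :=
  u 0 ord0 + dot (\row_i u 0 (lift ord0 i)) x.

Lemma aff_P1 u : is_P1 (aff u).
Proof. by exists (u 0 ord0), (\row_i u 0 (lift ord0 i)). Qed.

Lemma P1_aff (f : V -> R) : is_P1 f -> exists u, f = aff u.
Proof.
move=> [c [g fE]].
exists (\row_i if unlift ord0 i is Some j then g 0 j else c); apply/funext => x.
rewrite fE /aff mxE unlift_none; congr (_ + dot _ x).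
by apply/rowP => i; rewrite !mxE liftK.
Qed.

Lemma aff_lin a u v x : aff (a *: u + v) x = a * aff u x + aff v x.
Proof.
rewrite /aff !mxE mulrDr addrACA -dotZl -dotDl; congr (_ + dot _ x).
by apply/rowP => i; rewrite !mxE.
Qed.

Lemma aff_eq0 u : aff u = (fun _ => 0) -> u = 0.
Proof.
move=> u0; have h x : aff u x = 0 by rewrite u0.
have e0 : u 0 ord0 = 0 by have := h 0; rewrite /aff dotC dot0l addr0.
apply/rowP => i; rewrite mxE; case: (unliftP ord0 i) => [j|] -> //.
have := h (delta_mx 0 j); rewrite /aff e0 add0r /dot (bigD1 j)//= !mxE !eqxx mulr1.
by rewrite big1 ?addr0// => k /negbTE kj; rewrite !mxE kj mulr0.
Qed.

Variables (T : 'I_d.+2 -> V) (x0 n : V) (mu : R) (t : 'I_d -> V)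
  (Gamma : set V) (Bp Bm : V -> 'M[R]_d.+1).
Hypothesis uT : edge_mx T \in unitmx.
Let iT : aff_indep T := unitmx_aff_indep uT.

Local Notation aff_pair w := (aff (lsubmx w), aff (rsubmx w)).

Lemma flux_lin (A : 'M[R]_d.+1) a u v :
  flux x0 n A (aff (a *: u + v)) = a * flux x0 n A (aff u) + flux x0 n A (aff v).
Proof.
rewrite /flux !(P1_grad _ (fun x => erefl (aff _ x))) -dotZl -dotDl; congr dot.
by rewrite scalemxAl -mulmxDl; congr (_ *m _); apply/rowP => i; rewrite !mxE.
Qed.

Lemma J_lin i a (u v : 'rV[R]_(d.+2 + d.+2)) :
  J T x0 n mu t Gamma Bp Bm i (aff_pair (a *: u + v)) =
  a * J T x0 n mu t Gamma Bp Bm i (aff_pair u) + J T x0 n mu t Gamma Bp Bm i (aff_pair v).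
Proof.
rewrite /J !linearP /=; case: unlift => [j|]; first by rewrite !aff_lin; ring.
by rewrite !flux_lin; ring.
Qed.

(** For integrands with jumps, linearity needs the integrability provided by
    [cutoff_integrable]. *)
Lemma cutoff_int_lin m up (delta p q : 'I_m.+1 -> R) a :
  std_simplex_int 1 (fun s => cutoff up delta s * bary (fun i => a * p i + q i) s) =
  a * std_simplex_int 1 (fun s => cutoff up delta s * bary p s) +
  std_simplex_int 1 (fun s => cutoff up delta s * bary q s).
Proof.
have [_ <-] := std_simplex_int_lin a (cutoff_integrable up delta p)
  (cutoff_integrable up delta q).
by congr std_simplex_int; apply/funext => s; rewrite bary_lin; ring.
Qed.

Lemma M_lin k a (u v : 'rV[R]_(d.+2 + d.+2)) :
  M T x0 n k (aff_pair (a *: u + v)) = a * M T x0 n k (aff_pair u) + M T x0 n k (aff_pair v).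
Proof.
rewrite !M_cutoffE //=; try exact: aff_P1.
rewrite !linearP /=.
have E w w' : aff (a *: w + w') \o T \o lift k =
    fun i => a * (aff w \o T \o lift k) i + (aff w' \o T \o lift k) i.
  by apply/funext => i; rewrite /= aff_lin.
by rewrite !E !cutoff_int_lin; ring.
Qed.

Hypotheses (hd : d = 1%N \/ d = 2%N) (nn : dot n n = 1) (ht : tangent_frame n t)
  (hmu : mu * mesh_diam T != 0)
  (ell_p : 0 < quad_form (Bp (projection n Gamma x0)) n)
  (ell_m : 0 < quad_form (Bm (projection n Gamma x0)) n).

(** Here [theta] is the constant of [face_pos_int_slope] for the heights of the
    vertices, and [c] is the jump of the normal derivative. *)
Lemma kernel_trivial (phi : (V -> R) * (V -> R)) :
  is_P1 phi.1 -> is_P1 phi.2 ->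
  (forall i, J T x0 n mu t Gamma Bp Bm i phi = 0) ->
  (forall k, M T x0 n k phi = 0) ->
  phi.1 = (fun _ => 0) /\ phi.2 = (fun _ => 0).
Proof.
case: phi => f1 f2 /= P1 P2 J0 M0; have [a1 [g1 f1E]] := P1; have [a2 [g2 f2E]] := P2.
have Jx (j : 'I_d.+1) : f1 (xbar T x0 mu t j) = f2 (xbar T x0 mu t j).
  by apply/eqP; rewrite -subr_eq0; have := J0 (lift ord_max j); rewrite /J liftK /= => ->.
have fx0 : f1 x0 = f2 x0 by have := Jx ord0; rewrite /xbar unlift_none.
have gt j : dot (g1 - g2) (t j) = 0.
  have := Jx (lift ord0 j); rewrite /xbar liftK; move: fx0; rewrite !f1E !f2E.
  rewrite !dotDr !dotZr dotDl dotNl => e1 e2; apply: (mulfI hmu); lra.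
have gE := tangent_decomposition nn ht gt.
set c := dot (g1 - g2) n in gE.
have f12 x : f1 x = c * height x0 n x + f2 x.
  have : dot (g1 - g2) (x - x0) = c * height x0 n x.
    by rewrite gE dotZl dotC.
  by move: fx0; rewrite dotDl dotNl !dotDr !dotNr !f1E !f2E; lra.
pose delta i := height x0 n (T i).
(* The vertices affinely span the space. *)
have vertex_const (g : V) : (forall i, dot g (T i) = dot g (T ord0)) -> g = 0.
  move=> gT; apply/trmx_inj; rewrite trmx0 -[LHS](mulKmx uT) (_ : _ *m g^T = 0) ?mulmx0//.
  apply/matrixP => i j; rewrite !ord1 !mxE.
  transitivity (dot (T (lift ord0 i) - T ord0) g).
    by apply: eq_bigr => k _; rewrite !mxE.
  by rewrite dotDl dotNl ![dot _ g]dotC gT subrr.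
have mean0 k : (\sum_j f2 (T (lift k j))) / d.+1`!%:R + c * pos_int (delta \o lift k) = 0.
  have := M0 k; rewrite M_cutoffE//= => /eqP; rewrite mulf_eq0 pnatr_eq0 eqn0Ngt fact_gt0 /=.
  move=> /eqP eq0; apply: etrans eq0; apply: esym.
  have E : f1 \o T \o lift k = fun i => c * delta (lift k i) + f2 (T (lift k i)).
    by apply/funext => i; rewrite /= f12.
  rewrite E; apply: (@cutoff_int_sum R d [exists i, 0 < delta i] [exists i, delta i < 0]
    (delta \o lift k) (f2 \o T \o lift k) c).
  - by move=> i di; apply/existsP; exists (lift k i).
  - by move=> i di; apply/existsP; exists (lift k i).
  - move=> d0; have dk : delta k != 0.
      apply/eqP => dk; have : n = 0.
        apply: vertex_const => i.
        have di j : delta j = 0 by case: (unliftP k j) => [j'|] -> //; exact: d0.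
        have := di i; have := di ord0; rewrite /delta /height !dotDl !dotNl ![dot _ n]dotC.
        lra.
      by move=> n0; move: nn; rewrite n0 dot0l; lra.
    have dE i : delta i = (i == k)%:R * delta k.
      case: (unliftP k i) => [j|] ->; last by rewrite eqxx mul1r.
      by rewrite eq_sym (negbTE (neq_lift k j)) mul0r; exact: d0.
    have sgn (P : R -> bool) : P 0 = false -> [exists i, P (delta i)] = P (delta k).
      move=> P0; apply/existsP/idP => [[i]|Pk]; last by exists k.
      by rewrite dE; case: eqP => [_|_]; rewrite ?mul1r// mul0r P0.
    rewrite (sgn (fun z => 0 < z)) ?ltxx// (sgn (fun z => z < 0)) ?ltxx//.
    by case: (ltgtP (delta k) 0) dk.
have [theta /andP[th0 th1] thE] := face_pos_int_slope delta hd.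
(* The sum of f2 over the vertices of face k is the full sum minus the value at
   vertex k, and it equals -c times N! mu_k by [mean0]. *)
have diff k l : f2 (T k) - f2 (T l) = c * theta * (delta l - delta k).
  have f0 : d.+1`!%:R != 0 :> R by rewrite pnatr_eq0 -lt0n fact_gt0.
  have sum_face j : f2 (T j) + \sum_i f2 (T (lift j i)) = \sum_i f2 (T i).
    by rewrite [RHS](bigD1_ord j).
  have mE j : \sum_i f2 (T (lift j i)) = - c * (d.+1`!%:R * pos_int (delta \o lift j)).
    apply: (mulIf (invr_neq0 f0)); have := mean0 j.
    have -> : - c * (d.+1`!%:R * pos_int (delta \o lift j)) / d.+1`!%:R =
        - (c * pos_int (delta \o lift j)) by field.
    by move=> /eqP; rewrite addr_eq0 => /eqP.
  have := thE k l; have := sum_face k; have := sum_face l; rewrite !mE -!mulrA => e1 e2 <-.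
  lra.
have g2E : g2 = - (c * theta) *: n.
  apply/eqP; rewrite -subr_eq0 -scaleNr opprK; apply/eqP; apply: vertex_const => i.
  have := diff i ord0; rewrite !f2E /delta /height !dotDl !dotNl !dotZl ![dot _ n]dotC; lra.
have g1E : g1 = (c - c * theta) *: n.
  by rewrite -[g1](subrK g2) gE g2E -scalerDl.
have c0 : c = 0.
  have := J0 ord_max; rewrite /J unlift_none /flux (P1_grad _ f1E) (P1_grad _ f2E).
  rewrite g1E g2E -!scalemxAl !dotZl ![dot (n *m _) n]dotC.
  rewrite -/(quad_form (Bp _) n) -/(quad_form (Bm _) n).
  move: ell_p ell_m; set Qp := quad_form _ n; set Qm := quad_form _ n => qp qm e.
  have : c * ((1 - theta) * Qp + theta * Qm) = 0 by lra.
  by move=> /eqP; rewrite mulf_eq0 => /orP[/eqP//|/eqP]; nra.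
have g20 : g2 = 0 by rewrite g2E c0 mul0r oppr0 scale0r.
have f2c x : f2 x = a2 by rewrite f2E g20 dot0l addr0.
have a20 : a2 = 0.
  have := mean0 ord0; rewrite c0 mul0r addr0 (eq_bigr (fun _ => a2)) => [|i _]; last exact: f2c.
  move=> /eqP; rewrite sumr_const card_ord mulf_eq0 invr_eq0 pnatr_eq0.
  rewrite [d.+1`! == _]eqn0Ngt fact_gt0 orbF.
  by rewrite mulrn_eq0 /= => /eqP.
by split; apply/funext => x; rewrite ?f12 f2c ?c0 ?mul0r ?add0r a20.
Qed.

End LinearSystem.

(** The origin of the frame lies in the domain on which the shift to the
    interface is assumed to exist. *)
Lemma projection_in_interface (R : realType) (d : nat) (T : 'I_d.+2 -> 'rV[R]_d.+1)
  (x0 n : 'rV[R]_d.+1) mu t Gamma :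
  0 <= mu * mesh_diam T ->
  projection_well_defined T x0 n mu t Gamma -> Gamma (projection n Gamma x0).
Proof.
move=> mu0 hp; have [|r [r_shift _]] := hp x0.
  exists (fun _ => 0); split => [i|]; first by rewrite lexx.
  by rewrite big1 ?addr0// => i _; rewrite scale0r.
rewrite /projection; have [] := @xgetPex _ 0 (smallest_shift n Gamma x0) _ => //.
by exists r.
Qed.

Theorem lemma3p1 (R : realType) (d : nat)
  (hN : d.+1 = 2%N \/ d.+1 = 3%N)
  (Omega Gamma Op Om : set 'rV[R]_d.+1) (n : 'rV[R]_d.+1 -> 'rV[R]_d.+1)
  (hOmega : convex_polyhedral_domain Omega)
  (hGamma : interface Omega Gamma Op Om n)
  (B Bp Bm : 'rV[R]_d.+1 -> 'M[R]_d.+1)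
  (hB : coefficient Op Om B Bp Bm)
  (I : Type) (Th : I -> set ('I_d.+2 -> 'rV[R]_d.+1))
  (hTh : forall h, triangulation Omega (Th h))
  (hreg : shape_regular Th)
  (hcut : forall h, interface_resolved Gamma (Th h))
  (x0 nT : I -> ('I_d.+2 -> 'rV[R]_d.+1) -> 'rV[R]_d.+1)
  (hL : approximating_planes Gamma n Th x0 nT)
  (t : I -> ('I_d.+2 -> 'rV[R]_d.+1) -> 'I_d -> 'rV[R]_d.+1)
  (ht : forall h T, interface_element Gamma (Th h) T ->
     tangent_frame (nT h T) (t h T))
  (mu : R) (hmu : 0 < mu)
  (hp : forall h T, interface_element Gamma (Th h) T ->
     projection_well_defined T (x0 h T) (nT h T) mu (t h T) Gamma)
  (h : I) (T : 'I_d.+2 -> 'rV[R]_d.+1)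
  (hT : interface_element Gamma (Th h) T)
  (a m : 'I_d.+2 -> R) :
  exists! phi : ('rV[R]_d.+1 -> R) * ('rV[R]_d.+1 -> R),
    [/\ is_P1 phi.1, is_P1 phi.2,
        forall i, J T (x0 h T) (nT h T) mu (t h T) Gamma Bp Bm i phi = a i &
        forall k, M T (x0 h T) (nT h T) k phi = m k].

Proof.
have hd : d = 1%N \/ d = 2%N by case: hN => -[->]; [left|right].
have uT := triangulation_nondegenerate (hTh h) hT.1.
have iT := unitmx_aff_indep uT.
have [C hC] := hL; have [n1 _ _] := hC h T hT.
have nn : dot (nT h T) (nT h T) = 1.
  by rewrite -(sqr_sqrtr (dot_ge0 _)) -/(enorm _) n1 expr1n.
have nn0 : nT h T != 0 by rewrite -dot_eq0 nn oner_neq0.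
have diam0 : 0 < mu * mesh_diam T by rewrite mulr_gt0// ediam_simplex_gt0.
have pG := projection_in_interface (ltW diam0) (hp h T hT).
have [ell_p ell_m] := interface_elliptic hGamma hB pG nn0.
pose aff_pair (w : 'rV[R]_(d.+2 + d.+2)) := (aff (lsubmx w), aff (rsubmx w)).
pose Jh i phi := J T (x0 h T) (nT h T) mu (t h T) Gamma Bp Bm i phi.
pose Mh k phi := M T (x0 h T) (nT h T) k phi.
pose L w : 'rV[R]_(d.+2 + d.+2) :=
  row_mx (\row_i Jh i (aff_pair w)) (\row_k Mh k (aff_pair w)).
have LE w (b c : 'I_d.+2 -> R) : L w = row_mx (\row_i b i) (\row_k c k) <->
    (forall i, Jh i (aff_pair w) = b i) /\ (forall k, Mh k (aff_pair w) = c k).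
  split=> [/eq_row_mx[/rowP Jb /rowP Mc]|[Jb Mc]].
    by split=> i; [have := Jb i|have := Mc i]; rewrite !mxE.
  by congr row_mx; apply/rowP => i; rewrite !mxE.
have L_lin c u v : L (c *: u + v) = c *: L u + L v.
  rewrite /L scale_row_mx add_row_mx.
  by congr row_mx; apply/rowP => i; rewrite !mxE; [exact: J_lin|exact: M_lin].
have L_inj u : L u = 0 -> u = 0.
  move=> Lu; have /LE[J0 M0] : L u = row_mx (\row_i 0) (\row_k 0).
    by rewrite Lu (_ : \row_i 0 = 0) ?row_mx0//; apply/rowP => i; rewrite !mxE.
  have [/= e1 e2] := kernel_trivial uT hd nn (ht h T hT) (lt0r_neq0 diam0) ell_p ell_m
    (phi := aff_pair u) (aff_P1 _) (aff_P1 _) J0 M0.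
  by rewrite -[LHS]hsubmxK (aff_eq0 e1) (aff_eq0 e2) row_mx0.
have [w /LE[Jw Mw]] := row_linear_surj L_lin L_inj (row_mx (\row_i a i) (\row_k m k)).
exists (aff_pair w); split; first by split=> //; exact: aff_P1.
move=> [f1 f2] [/= P1 P2 Jf Mf].
have [u1 E1] := P1_aff P1; have [u2 E2] := P1_aff P2.
have fE : (f1, f2) = aff_pair (row_mx u1 u2) by rewrite /aff_pair row_mxKl row_mxKr E1 E2.
rewrite fE; congr aff_pair; apply/eqP; rewrite -subr_eq0; apply/eqP; apply: L_inj.
rewrite addrC -scaleN1r L_lin scaleN1r addrC; apply/eqP; rewrite subr_eq0; apply/eqP.
transitivity (row_mx (\row_i a i) (\row_k m k)); first exact/LE.
by apply/esym/LE; rewrite -fE.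
Qed.
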